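(* Let $\alpha,\beta>-1$, $m\in\mathbb{N}$, and let $\kappa$ be a kernel in $\mathbb{L}_m(0,1]$ (that is, $\kappa$ is the second member of a pair $(k,\kappa)\in\mathbb{L}_m(0,1]$). Then the left Jacobi convolution series $\{\phi_n\}_{n=0}^\infty$, $$\phi_n(x)=\int_0^x\kappa(x-t)\,\tilde P_n^{\alpha,\beta}(t)\,dt,\qquad x\in[0,1],$$ form a basis of the infinite-dimensional Hilbert space $L_w^2[0,1]$.
   Context: $\mathbb{N}=\{1,2,\dots\}$. $P_n^{\alpha,\beta}$ is the Jacobi polynomial $$P_n^{\alpha,\beta}(x)=\frac1{2^n}\sum_{k=0}^n\binom{n+\alpha}{k}\binom{n+\beta}{n-k}(x-1)^{n-k}(x+1)^k,\qquad x\in[-1,1],$$ and $\tilde P_n^{\alpha,\beta}(x)=P_n^{\alpha,\beta}(2x-1)$, $x\in[0,1]$, is the shifted Jacobi polynomial. $L_w^2[0,1]$ is the weighted $L^2$ space with inner product $(u,v)_{L_w^2[0,1]}=\int_0^1 u(x)v(x)w(x)\,dx$ and Jacobi weight $w(x)=(2-2x)^\alpha(2x)^\beta$, with respect to which the $\tilde P_n^{\alpha,\beta}$ are orthogonal. ''Basis'' means that the $\phi_n$ are linearly independent and every $f\in L_w^2[0,1]$ can be approximated arbitrarily well in the norm of $L_w^2[0,1]$ by finite linear combinations of the $\phi_n$. For $\sigma\ge-1$, $C_\sigma(0,1]$ is the set of $h:(0,1]\to\mathbb{R}$ of the form $h(t)=t^p h_1(t)$ with some $p>\sigma$ and $h_1\in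 C[0,1]$, and $C_\sigma^m(0,1]=\{h:h^{(m)}\in C_\sigma(0,1]\}$. The class $\mathbb{L}_m(0,1]$ consists of the pairs $(k,\kappa)$ of functions in $C_{-1}^m(0,1]$ satisfying the left modified Sonine condition $\int_0^x k(x-t)\kappa(t)\,dt=\frac{x^{m-1}}{(m-1)!}$ for $0<x\le1$. *)

(* Defs.v *)
From HB Require Import structures.
From mathcomp Require Import all_boot all_order all_algebra.
From mathcomp Require Import all_classical all_reals all_analysis.

Set Implicit Arguments.
Unset Strict Implicit.
Unset Printing Implicit Defensive.

Import Order.TTheory GRing.Theory Num.Theory.
Import numFieldNormedType.Exports.

Local Open Scope classical_set_scope.
Local Open Scope ring_scope.

(* A function on (0,1] or on [0,1] is a total function R -> R of which only
   the values on that interval matter. *)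

Section JacobiPolynomials.
Variable R : realType.

(* Generalised binomial coefficient a (a - 1) ... (a - k + 1) / k!, real a. *)
Definition gbinom (a : R) (k : nat) : R :=
  (\prod_(j < k) (a - j%:R)) / k`!%:R.

Definition jacobi (alpha beta : R) (n : nat) : {poly R} :=
  (2 ^+ n)^-1 *: \sum_(k < n.+1)
    (gbinom (n%:R + alpha) k * gbinom (n%:R + beta) (n - k)) *:
      (('X - 1) ^+ (n - k) * ('X + 1) ^+ k).

Definition shifted_jacobi (alpha beta : R) (n : nat) : {poly R} :=
  jacobi alpha beta n \Po (2 *: 'X - 1).

Definition jacobi_weight (alpha beta x : R) : R :=
  (2 - 2 * x) `^ alpha * (2 * x) `^ beta.

End JacobiPolynomials.

Section WeightedL2.
Variable R : realType.
Notation leb := (@lebesgue_measure R).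

(* Elements of L^2_w[0,1] are represented by functions; equality in the space
   is equality almost everywhere on [0,1]. *)
Definition L2w (w f : R -> R) : Prop :=
  measurable_fun (`[0%R, 1%R]%classic : set (measurableTypeR R)) f /\
  (\int[leb]_(x in `[0%R, 1%R]) (f x ^+ 2 * w x)%:E < +oo)%E.

Definition L2w_inner (w u v : R -> R) : R :=
  \int[leb]_(x in `[0%R, 1%R]) (u x * v x * w x).

Definition L2w_norm (w u : R -> R) : R := Num.sqrt (L2w_inner w u u).

Definition L2w_lin_indep (phi : nat -> R -> R) : Prop :=
  forall (N : nat) (c : 'I_N -> R),
    {ae leb, forall x, x \in `[0, 1] -> \sum_(i < N) c i * phi i x = 0} ->
    forall i, c i = 0.

Definition L2w_complete_system (w : R -> R) (phi : nat -> R -> R) : Prop :=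
  forall f, L2w w f -> forall eps : R, 0 < eps ->
    exists (N : nat) (c : 'I_N -> R),
      L2w_norm w (fun x => f x - \sum_(i < N) c i * phi i x) < eps.

Definition L2w_basis (w : R -> R) (phi : nat -> R -> R) : Prop :=
  [/\ forall n, L2w w (phi n), L2w_lin_indep phi & L2w_complete_system w phi].

End WeightedL2.

Section Kernels.
Variable R : realType.
Notation leb := (@lebesgue_measure R).

Definition Csigma (sigma : R) (h : R -> R) : Prop :=
  exists (p : R) (h1 : R -> R),
    [/\ sigma < p,
        {within `[0%R, 1%R], continuous h1} &
        forall t, t \in `]0, 1] -> h t = t `^ p * h1 t].

(* g is the derivative of h on D, with difference quotients taken inside D:
   at the endpoint 1 of (0,1] this is the left derivative. *)
Definition is_derive_on (D : set R) (h g : R -> R) : Prop :=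
  forall x, D x ->
    (fun y => (h y - h x) / (y - x)) @ within D x^' --> g x.

Fixpoint is_nderive_on (m : nat) (D : set R) (h g : R -> R) : Prop :=
  if m is m'.+1 then
    exists2 h', is_derive_on D h h' & is_nderive_on m' D h' g
  else forall x, D x -> h x = g x.

Definition Csigmam (m : nat) (sigma : R) (h : R -> R) : Prop :=
  exists2 g, is_nderive_on m `]0%R, 1%R] h g & Csigma sigma g.

Definition convol (k f : R -> R) (x : R) : R :=
  \int[leb]_(t in `[0%R, x]) (k (x - t) * f t).

(* (k, kappa) belongs to the class L_m(0,1]. *)
Definition left_sonine_pair (m : nat) (k kappa : R -> R) : Prop :=
  [/\ Csigmam m (-1) k, Csigmam m (-1) kappa &
      forall x, x \in `]0, 1] -> convol k kappa x = x ^+ m.-1 / (m.-1)`!%:R].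

Definition left_jacobi_convolution (alpha beta : R) (kappa : R -> R) (n : nat) :
    R -> R :=
  convol kappa (fun t => (shifted_jacobi alpha beta n).[t]).

End Kernels.

(* Main.v *)
(* Since kappa^(m) = O(t^p) with p > -1 and m >= 1, integrating shows that k and
   kappa extend continuously to [0,1].  Write * for the convolution
   (f * g)(x) = \int_0^x f(x - t) g(t) dt, and e_m = x^(m-1)/(m-1)!, so that
   k * kappa = e_m.  On polynomials, * is computed by the Borel transform, which
   turns it into X times the product; in particular it is associative and
   commutative.  Let a, b be polynomials uniformly close to k, kappa
   (Weierstrass).
   Completeness: for a polynomial r, the polynomial p = a * r satisfies
   kappa * p ~ b * (a * r) = (a * b) * r ~ e_m * r uniformly on [0,1], and e_m * r
   ranges over all the multiples of X^m.  These are dense in L^2_w, as w is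
   integrable; and since deg P_n = n, p is a combination of the first P_n.
   Independence: if kappa * p = 0 a.e. then b * p ~ 0, whence
   e_m * p ~ (a * b) * p = a * (b * p) ~ 0, so e_m * p = 0 and p = 0. *)
Require Import Defs.
From mathcomp Require Import all_boot all_order all_algebra.
From mathcomp Require Import all_classical all_reals all_analysis.
From mathcomp Require Import measurable_realfun ring lra.

Set Implicit Arguments.
Unset Strict Implicit.
Unset Printing Implicit Defensive.

Import Order.TTheory GRing.Theory Num.Theory.
Import numFieldNormedType.Exports.

Local Open Scope classical_set_scope.
Local Open Scope ring_scope.

(** * Degrees of the Jacobi polynomials *)

Section JacobiDegree.
Variable R : realType.

Lemma gbinom_gt0 (a : R) (k : nat) :
  (forall j : nat, (j < k)%N -> j%:R < a) -> 0 < gbinom a k.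
Proof.
move=> ak; rewrite divr_gt0 ?ltr0n ?fact_gt0//.
by apply: prodr_gt0 => j _; rewrite subr_gt0 ak.
Qed.

Lemma monic_size_binom (n k : nat) : (k <= n)%N ->
  let p := ('X - 1) ^+ (n - k) * ('X + 1) ^+ k : {poly R} in
  p \is monic /\ size p = n.+1.
Proof.
move=> kn /=.
have m1 : ('X - 1 : {poly R}) \is monic by rewrite -polyC1 monicXsubC.
have m2 : ('X + 1 : {poly R}) \is monic by rewrite -polyC1 monicXaddC.
have s1 : size ('X - 1 : {poly R}) = 2 by rewrite -polyC1 size_XsubC.
have s2 : size ('X + 1 : {poly R}) = 2 by rewrite -polyC1 size_XaddC.
split; first by rewrite monicMl ?monic_exp.
rewrite size_monicM ?monic_exp ?monic_neq0 ?monic_exp//.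
have sX (p : {poly R}) j : p \is monic -> size p = 2 -> size (p ^+ j) = j.+1.
  move=> mp sp; apply/eqP; rewrite -(@prednK (size (p ^+ j))).
    by rewrite size_exp sp/= mul1n.
  by rewrite size_poly_gt0 monic_neq0 ?monic_exp.
by rewrite !sX// addnS/= addSn subnK.
Qed.

(** Each product of powers in the sum is monic of degree n, so the coefficient of X^n is 2^(-n)
    times the sum of the binomial factors. All of these are positive: for j < k <= n the factor n +
    alpha - j exceeds n - 1 - j >= 0, and likewise with beta. *)
Lemma size_jacobi (alpha beta : R) (n : nat) : -1 < alpha -> -1 < beta ->
  size (jacobi alpha beta n) = n.+1.
Proof.
move=> a1 b1; apply/eqP; rewrite eqn_leq; apply/andP; split.
  rewrite (leq_trans (size_scale_leq _ _))// (leq_trans (size_sum _ _ _))//.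
  apply/bigmax_leqP => k _; rewrite (leq_trans (size_scale_leq _ _))//.
  by have [|_ ->] := @monic_size_binom n k _; first by rewrite -ltnS.
rewrite ltnNge; apply/negP => sn.
have : (jacobi alpha beta n)`_n = 0 by rewrite nth_default.
rewrite coefZ coef_sum => /eqP; rewrite mulf_eq0 invr_eq0 expf_eq0 pnatr_eq0 andbF/=.
apply/negP; rewrite gt_eqF//.
have lt_shift (c : R) (j i : nat) : -1 < c -> (i < j)%N -> (j <= n)%N ->
    i%:R < n%:R + c.
  move=> c1 ij jn; have : i.+1%:R <= n%:R :> R by rewrite ler_nat (leq_trans ij).
  by rewrite -natr1; lra.
have tpos (k : 'I_n.+1) : 0 < ((gbinom (n%:R + alpha) k *
   gbinom (n%:R + beta) (n - k)) *: (('X - 1) ^+ (n - k) * ('X + 1) ^+ k))`_n.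
  have [|mp sp] := @monic_size_binom n k _; first by rewrite -ltnS.
  rewrite coefZ; move/monicP : mp; rewrite /lead_coef sp/= => ->.
  rewrite mulr1 mulr_gt0// gbinom_gt0// => j jk.
    by apply: (lt_shift _ k) => //; rewrite -ltnS.
  by apply: (lt_shift _ (n - k)%N) => //; rewrite leq_subr.
rewrite big_ord_recl ltr_pwDl//.
by apply: sumr_ge0 => i _; exact/ltW/(tpos (lift ord0 i)).
Qed.

Lemma size_shifted_jacobi (alpha beta : R) (n : nat) : -1 < alpha -> -1 < beta ->
  size (shifted_jacobi alpha beta n) = n.+1.
Proof.
move=> a1 b1; rewrite size_comp_poly2 ?size_jacobi//.
rewrite -polyC1 -polyCN size_polyDl ?size_scale ?size_polyX ?pnatr_eq0//.
by rewrite size_polyC; case: eqP.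
Qed.

End JacobiDegree.

(** * Polynomial sequences with one member of each degree *)

Section DegreeBasis.
Variables (F : fieldType) (q : nat -> {poly F}).
Hypothesis size_q : forall n, size (q n) = n.+1.

Let lead_q n : (q n)`_n != 0.
Proof.
have := lead_coef_eq0 (q n); rewrite /lead_coef size_q/= => ->.
by rewrite -size_poly_gt0 size_q.
Qed.

(** Elimination from the top: a suitable multiple of [q N] cancels the coefficient of X^N and lowers
    the size. *)
Lemma size_basis_span (N : nat) (p : {poly F}) : (size p <= N)%N ->
  exists c : 'I_N -> F, p = \sum_(i < N) c i *: q i.
Proof.
elim: N p => [|N IH] p.
  rewrite leqn0 size_poly_eq0 => /eqP ->.
  by exists (fun=> 0); rewrite big_ord0.
move=> sp; pose a := p`_N / (q N)`_N.
have [|c cE] := IH (p - a *: q N).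
  apply/leq_sizeP => j; rewrite leq_eqVlt => /predU1P[<-|Nj].
    by rewrite coefB coefZ mulfVK// subrr.
  rewrite coefB coefZ !nth_default ?mulr0 ?subr0// ?size_q//.
  exact: leq_trans Nj.
exists (fun i => if unlift ord_max i is Some j then c j else a).
rewrite big_ord_recr/= unlift_none; apply/(canRL (subrK _)).
rewrite cE; apply: eq_bigr => i _.
have -> : widen_ord (leqnSn N) i = lift ord_max i.
  by apply: val_inj; rewrite /= /bump leqNgt ltn_ord.
by rewrite liftK.
Qed.

(** The top coefficient of the sum comes from the last member alone, so its scalar vanishes; then
    induction. *)
Lemma size_basis_free (N : nat) (c : 'I_N -> F) :
  \sum_(i < N) c i *: q i = 0 -> forall i, c i = 0.
Proof.
elim: N c => [|N IH] c; first by move=> _ [].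
rewrite big_ord_recr/= => s0.
have cN : c ord_max = 0.
  have /(congr1 (fun p : {poly F} => p`_N)) := s0.
  rewrite coefD coefZ coef0 coef_sum big1 ?add0r.
    by move/eqP; rewrite mulf_eq0 (negbTE (lead_q N)) orbF => /eqP.
  by move=> i _; rewrite coefZ nth_default ?mulr0// size_q.
move: s0; rewrite cN scale0r addr0 => /IH c0 i.
have [j ->|->//] := unliftP ord_max i.
rewrite -(c0 j); congr (c _); apply: val_inj.
by rewrite /= /bump leqNgt ltn_ord.
Qed.

End DegreeBasis.

(** * Weierstrass approximation *)

Section Weierstrass.
Variable R : realType.

(* [bernstein n g] is the classical Bernstein polynomial
   [\sum_(k <= n) 'C(n, k) g(k) X^k (1 - X)^(n - k)], defined by the de Casteljau
   recursion, which avoids binomial coefficients. *)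
Fixpoint bernstein (n : nat) (g : nat -> R) : {poly R} :=
  if n is n'.+1 then
    (1 - 'X) * bernstein n' g + 'X * bernstein n' (fun k => g k.+1)
  else (g 0%N)%:P.

Lemma bernsteinS n g x : (bernstein n.+1 g).[x] =
  (1 - x) * (bernstein n g).[x] + x * (bernstein n (fun k => g k.+1)).[x].
Proof. by rewrite /= !hornerE. Qed.

Lemma le_bernstein n g h x : 0 <= x <= 1 ->
  (forall k, (k <= n)%N -> g k <= h k) ->
  (bernstein n g).[x] <= (bernstein n h).[x].
Proof.
move=> /andP[x0 x1]; elim: n g h => [|n IH] g h gh; first by rewrite /= !hornerE gh.
rewrite !bernsteinS lerD// ler_wpM2l ?subr_ge0//; apply: IH => k kn; apply: gh => //.
exact: leqW.
Qed.

(* Mean [n x] and variance [n x (1 - x)] of the binomial distribution. *)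
Lemma bernstein_quad n (a c y x : R) :
  (bernstein n (fun k => a + c * (k%:R - y) ^+ 2)).[x] =
  a + c * ((n%:R * x - y) ^+ 2 + n%:R * x * (1 - x)).
Proof.
elim: n a c y => [|n IH] a c y; first by rewrite /= !hornerE; ring.
rewrite bernsteinS IH.
have -> : (fun k => a + c * (k.+1%:R - y) ^+ 2) =
    (fun k => a + c * (k%:R - (y - 1)) ^+ 2).
  by apply/funext => k; rewrite -natr1; ring.
by rewrite IH -natr1; ring.
Qed.

Lemma bounded_on_unit_interval (f : R -> R) : {in `[0, 1], continuous f} ->
  exists2 M : R, 0 <= M & forall x, x \in `[0, 1] -> `|f x| <= M.
Proof.
move=> cf.
have cf' : {within `[0, 1], continuous f}.
  by apply: continuous_in_subspaceT => x; rewrite inE => /cf.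
have [M [_ Mf]] := compact_bounded (continuous_compact cf' (@segment_compact R 0 1)).
exists (`|M| + 1) => [|x x01]; first by rewrite addr_ge0.
by apply: (Mf (`|M| + 1)); [rewrite (le_lt_trans (ler_norm M)) ?ltrDl|exists x].
Qed.

(** A modulus of continuity in a form whose Bernstein polynomial is known exactly. If x and y are
    close, e suffices by continuity; otherwise the quadratic term exceeds twice the bound of |f|.
    Compactness makes n uniform. *)
Lemma quadratic_modulus (f : R -> R) (e : R) : 0 < e ->
  {in `[0, 1], continuous f} ->
  exists n : nat, forall x y, x \in `[0, 1] -> y \in `[0, 1] ->
    `|f x - f y| <= e + n%:R * (x - y) ^+ 2.
Proof.
move=> e0 cf.
have [M M0 fM] := bounded_on_unit_interval cf.
pose P n (x : R) := forall y, y \in `[0, 1] ->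
  `|f x - f y| <= e + n%:R * (x - y) ^+ 2.
have covP (x : R) : `[0, 1]%classic x ->
    \forall x' \near x & n \near \oo, `[0, 1]%classic x' -> P n x'.
  move=> x01; have /(_ _ x01) /cvgrPdist_lt cfx := cf.
  have /nbhs_ballP[d /= d0 fd] := cfx (e / 2) (divr_gt0 e0 (ltr0Sn R 1)).
  near=> x' n => x'01 y y01.
  have xx' : `|x - x'| < d / 2.
    near: x'; apply/nbhs_ballP; exists (d / 2) => //=; exact: divr_gt0.
  have [xy|yx] := ltP `|x - y| d.
    have fx' : `|f x - f x'| < e / 2.
      by apply: fd; rewrite /ball/= (lt_trans xx')// gtr_pMr// invf_lt1 ?ltr1n.
    have fy : `|f x - f y| < e / 2 by apply: fd.
    rewrite (le_trans (ler_distD (f x) _ _))// (distrC (f x')).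
    rewrite (le_trans (ltW (ltrD fx' fy)))// -splitr lerDl mulr_ge0//.
    exact: sqr_ge0.
  have x'y : d / 2 <= `|x' - y|.
    by have := ler_distD x' x y; move: xx' yx; lra.
  (* Chosen so that n (d / 2)^2 >= 2 M, which bounds |f x' - f y|. *)
  have nM : 8 * M / d ^+ 2 <= n%:R.
    near: n; exists (Num.truncn (8 * M / d ^+ 2)).+1 => // k /=.
    by rewrite -(ler_nat R); apply: le_trans; exact/ltW/truncnS_gt.
  have fM2 : `|f x' - f y| <= 2 * M.
    by rewrite (le_trans (ler_normB _ _))// mulr2n mulrDl mul1r lerD ?fM.
  rewrite (le_trans fM2)// ler_wpDl ?(ltW e0)//.
  rewrite -real_normK ?num_real//.
  have d24 : (d / 2) ^+ 2 <= `|x' - y| ^+ 2.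
    by rewrite lerXn2r// nnegrE// ltW// divr_gt0.
  rewrite (le_trans _ (ler_wpM2l (ler0n R n) d24))//.
  rewrite (le_trans _ (ler_wpM2r (sqr_ge0 (d / 2)) nM))//.
  by rewrite le_eqVlt; apply/orP; left; apply/eqP; field; rewrite gt_eqF.
have := @segment_compact R 0 1; rewrite compact_near_coveringP.
move=> /(_ nat \oo (fun n x' => `[0, 1]%classic x' -> P n x') _ covP) [n _ nP].
by exists n => x y x01 y01; apply: (nP n) => //=.
Unshelve. all: by end_near.
Qed.

(** Bernstein's proof: the values f(k/n) lie between two quadratics in k centred at n x. The
    Bernstein operator is monotone, and on these quadratics only the variance n x (1 - x) survives;
    its contribution is at most m / n <= e / 2. *)
Lemma weierstrass (f : R -> R) (e : R) : 0 < e ->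
  {in `[0, 1], continuous f} ->
  exists p : {poly R}, forall x, x \in `[0, 1] -> `|f x - p.[x]| <= e.
Proof.
move=> e0 cf; have [m fm] := quadratic_modulus (divr_gt0 e0 (ltr0Sn R 1)) cf.
have [N Nm] : exists N : nat, 2 * m%:R / e <= N.+1%:R :> R.
  exists (Num.truncn (2 * m%:R / e)); exact/ltW/truncnS_gt.
pose n := N.+1; have n0 : 0 < n%:R :> R by rewrite ltr0n.
exists (bernstein n (fun k => f (k%:R / n%:R))) => x x01.
have kn01 k : (k <= n)%N -> (k%:R / n%:R : R) \in `[0, 1].
  by move=> kn; rewrite in_itv/= divr_ge0//= ler_pdivrMr// mul1r ler_nat.
have x01' : 0 <= x <= 1 by move: x01; rewrite in_itv.
pose c := m%:R / n%:R ^+ 2 : R.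
have fkn k : (k <= n)%N ->
    `|f x - f (k%:R / n%:R)| <= e / 2 + c * (k%:R - n%:R * x) ^+ 2.
  move=> kn; rewrite (le_trans (fm _ _ x01 (kn01 _ kn)))//.
  rewrite le_eqVlt; apply/orP; left; apply/eqP; congr (_ + _).
  by rewrite /c; field; rewrite gt_eqF.
have c_small : c * (n%:R * x * (1 - x)) <= e / 2.
  have -> : c * (n%:R * x * (1 - x)) = m%:R / n%:R * (x * (1 - x)).
    by rewrite /c; field; rewrite gt_eqF.
  have mn : m%:R / n%:R <= e / 2 :> R.
    by rewrite ler_pdivrMr//; move: Nm; rewrite ler_pdivrMr// -/n; lra.
  rewrite (le_trans _ mn)// ler_piMr ?divr_ge0//.
  by move: x01' => /andP[]; nra.
have up := le_bernstein (n := n)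
  (h := fun k => (f x + e / 2) + c * (k%:R - n%:R * x) ^+ 2) x01' _.
have lo := le_bernstein (n := n)
  (g := fun k => (f x - e / 2) + (- c) * (k%:R - n%:R * x) ^+ 2) x01' _.
rewrite ler_distlC; apply/andP; split.
  apply: le_trans (lo _ _) => [|k kn].
    by rewrite bernstein_quad subrr expr0n/= add0r; lra.
  by have := fkn k kn; rewrite ler_distlC => /andP[]; lra.
apply: le_trans (up _ _) _ => [k kn|].
  by have := fkn k kn; rewrite ler_distlC => /andP[]; lra.
by rewrite bernstein_quad subrr expr0n/= add0r; lra.
Qed.

End Weierstrass.

(** * Continuous extension of the kernels *)

Section KernelExtension.
Variable R : realType.
Implicit Types (h g : R -> R).

(** Caratheodory's criterion, with the difference quotient completed by g x at x. At an interior
    point the restriction to (0,1] is void. *)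
Lemma is_derive_on_is_derive h g (x : R) : is_derive_on `]0, 1] h g ->
  x \in `]0, 1[ -> is_derive x 1 h (g x).
Proof.
move=> hg x01.
have xD : (`]0, 1]%classic : set R) x.
  by move: x01; rewrite /= !in_itv/= => /andP[-> /ltW].
apply/is_derive1_caratheodory.
exists (fun z => if z == x then g x else (h z - h x) / (z - x)); split.
- move=> z; case: eqVneq => [->|zx]; first by rewrite !subrr mulr0.
  by rewrite divfK// subr_eq0.
- apply/continuous_withinNx; rewrite eqxx.
  apply/cvgrPdist_lt => e e0.
  have /cvgrPdist_lt /(_ e e0) := hg x xD.
  rewrite near_withinE => H.
  near=> z; have zx : z != x by near: z; exact: nbhs_dnbhs_neq.
  rewrite (negbTE zx); apply: (near H z) => //=.
  near: z; apply: nbhs_dnbhs.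
  have : \forall z \near x, z \in `]0, 1[ by exact: near_in_itvoo.
  by apply: filterS => z; rewrite /= !in_itv/= => /andP[-> /ltW].
- by rewrite eqxx.
Unshelve. all: by end_near. Qed.

(** Near x the difference quotient is within 1 of g x, so |h z - h x| <= (|g x| + 1) |z - x|. *)
Lemma is_derive_on_continuous h g : is_derive_on `]0, 1] h g ->
  {within `]0, 1], continuous h}.
Proof.
move=> hg.
suff main (x e : R) : `]0, 1]%classic x -> 0 < e ->
    \forall z \near x, `]0, 1]%classic z -> `|h x - h z| < e.
  apply/subspace_continuousP => x xD; apply/cvgrPdist_lt => e e0.
  by rewrite near_withinE; exact: main.
move=> xD e0; have /cvgrPdist_lt /(_ 1 ltr01) := hg x xD.
rewrite !near_withinE => H.
have H' : \forall z \near x, z != x -> `]0, 1]%classic z ->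
  `|g x - (h z - h x) / (z - x)| < 1 by exact: H.
pose B := `|g x| + 1.
have B0 : 0 < B by rewrite ltr_wpDl.
near=> z => zD.
have [->|zx] := eqVneq z x; first by rewrite subrr normr0.
have Hz : `|g x - (h z - h x) / (z - x)| < 1 by apply: (near H' z).
have zxe : `|x - z| < e / B.
  by near: z; apply/nbhs_ballP; exists (e / B); rewrite /= ?divr_gt0.
have zx0 : z - x != 0 by rewrite subr_eq0.
have -> : h x - h z = (h z - h x) / (z - x) * (x - z).
  by rewrite -(opprB z x) mulrN divfK// opprB.
rewrite normrM.
have qB : `|(h z - h x) / (z - x)| <= B.
  have := ler_distD (g x) 0 ((h z - h x) / (z - x)).
  rewrite !sub0r !normrN /B; move: Hz; lra.
rewrite (le_lt_trans (ler_wpM2r _ qB))// mulrC.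
by rewrite -ltr_pdivlMr.
Unshelve. all: by end_near. Qed.

(** The mean value theorem shows that h - C t^q and -h - C t^q do not increase from s to t, as their
    derivatives are nonpositive. *)
Lemma derive_powR_bound h g (C q s : R) : 0 < q ->
  is_derive_on `]0, 1] h g ->
  (forall t : R, t \in `]0, 1] -> `|g t| <= C * (q * t `^ (q - 1))) ->
  forall t : R, 0 < s -> s <= t -> t <= 1 -> `|h t - h s| <= C * (t `^ q - s `^ q).
Proof.
move=> q0 hg gC t s0 st t1.
have sub : `[s, t] `<=` (`]0, 1] : set R).
  move=> u; rewrite /= !in_itv/= => /andP[su ut].
  by rewrite (lt_le_trans s0 su) (le_trans ut t1).
have oo u : u \in `]s, t[ -> u \in `]0, 1[.
  by rewrite !in_itv/= => /andP[su ut]; rewrite (lt_trans s0 su) (lt_le_trans ut t1).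
have ch : {within `[s, t], continuous h}.
  exact: continuous_subspaceW sub (is_derive_on_continuous hg).
have cp : {within `[s, t], continuous (fun t : R => t `^ q)}.
  apply: derivable_within_continuous => u us; apply: derivable_powR.
  by have /= := sub _ us; rewrite !in_itv/= => /andP[->].
have main (a : R) : `|a| = 1 -> a * h t - C * t `^ q <= a * h s - C * s `^ q.
  move=> a1.
  pose f u := a * h u - C * u `^ q; pose df u := a * g u - C * (q * u `^ (q - 1)).
  have fdf u : u \in `]s, t[ -> is_derive u 1 f (df u).
    move=> us; have hu := is_derive_on_is_derive hg (oo _ us).
    have u0 : 0 < u by have := oo _ us; rewrite in_itv/= => /andP[].
    have pu := is_derive1_powR q u0.
    have := is_deriveB (is_deriveZ a hu) (is_deriveZ C pu).
    by [].
  have cf : {within `[s, t], continuous f}.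
    move=> x; apply: cvgB; apply: cvgM; [exact: cvg_cst|exact: ch|exact: cvg_cst|exact: cp].
  have [c cst fE] := MVT_segment st fdf cf.
  rewrite -subr_le0 [X in X <= 0]fE mulr_le0_ge0 ?subr_ge0//.
  rewrite subr_le0 (le_trans (ler_norm _))// normrM a1 mul1r.
  by apply: gC; exact: sub.
have := main 1 (normr1 _); have := main (-1).
rewrite normrN normr1 => /(_ erefl) h1 h2.
by rewrite ler_norml; apply/andP; split; nra.
Qed.

(** The pair [Mp] is (M, p) in the bound M t^p. The condition p > -1 makes the bound integrable at
    0, so that the property passes from a derivative to the function. *)
Definition powR_dominated h : Prop := exists2 Mp : R * R, -1 < Mp.2 &
  forall t : R, t \in `]0, 1] -> `|h t| <= Mp.1 * t `^ Mp.2.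

Lemma Csigma_powR_dominated h : Csigma (-1) h -> powR_dominated h.
Proof.
move=> [p [h1 [p1 ch1 hE]]].
have [M [_ Mh]] := compact_bounded (continuous_compact ch1 (@segment_compact R 0 1)).
exists (`|M| + 1, p) => //= t t01; rewrite hE// normrM mulrC (ger0_norm (powR_ge0 _ _)).
rewrite ler_wpM2r ?powR_ge0//; apply: (Mh (`|M| + 1)).
  by rewrite (le_lt_trans (ler_norm M)) ?ltrDl.
by exists t => //; move: t01; rewrite /= !in_itv/= => /andP[/ltW -> ->].
Qed.

(** Integrating M t^p gives (M / q) t^q with q = p + 1 > 0. The positive exponent yields both
    boundedness of h and its limit at 0. *)
Lemma dominated_derive_modulus h g : is_derive_on `]0, 1] h g ->
  powR_dominated g ->
  exists C q : R, [/\ 0 <= C, 0 < q & forall s t : R, 0 < s -> s <= t -> t <= 1 ->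
    `|h t - h s| <= C * (t `^ q - s `^ q)].
Proof.
move=> hg [[M p] /= p1 gM]; pose q := p + 1.
have q0 : 0 < q by rewrite /q -ltrBlDr sub0r.
have M0 : 0 <= M.
  have := gM 1; rewrite in_itv/= lexx ltr01 powR1/= mulr1 => /(_ isT).
  exact: le_trans.
exists (M / q), q; split=> //; first by rewrite divr_ge0// ltW.
move=> s t s0 st t1; apply: derive_powR_bound hg _ _ s0 st t1 => // u u01.
rewrite mulrA divfK ?gt_eqF// /q addrK; exact: gM.
Qed.

Lemma dominated_derive_bounded h g : is_derive_on `]0, 1] h g ->
  powR_dominated g -> exists M, forall t : R, t \in `]0, 1] -> `|h t| <= M.
Proof.
move=> hg dg; have [C [q [C0 q0 hC]]] := dominated_derive_modulus hg dg.
exists (`|h 1| + C) => t; rewrite in_itv/= => /andP[t0 t1].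
have := hC t 1 t0 t1 (lexx _); rewrite powR1.
have : C * (1 - t `^ q) <= C by rewrite ler_piMr// gerBl powR_ge0.
have := ler_distD (h 1) 0 (h t); rewrite !sub0r !normrN.
lra.
Qed.

Lemma nderive_powR_dominated (m : nat) h g : is_nderive_on m `]0, 1] h g ->
  powR_dominated g -> powR_dominated h.
Proof.
elim: m h => [|m IH] h /=.
  move=> hg [Mp p1 gM]; exists Mp => // t t01; rewrite hg//; exact: gM.
move=> [h' hh' h'g] dg.
have [M hM] := dominated_derive_bounded hh' (IH _ h'g dg).
(* A bounded function is dominated with exponent 0. *)
exists (M, 0) => [|t t01] /=; first by rewrite ltrN10.
by rewrite powRr0 mulr1 hM.
Qed.

(** The function h + C t^q is nondecreasing and bounded below, hence converges to its infimum at 0+,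
    while C t^q tends to 0. *)
Lemma dominated_derive_cvg0 h g : is_derive_on `]0, 1] h g ->
  powR_dominated g -> exists l : R, h t @[t --> 0^'+] --> l.
Proof.
move=> hg dg; have [C [q [C0 q0 hC]]] := dominated_derive_modulus hg dg.
have [M hM] := dominated_derive_bounded hg dg.
pose f (t : R) := h t + C * t `^ q.
have fl : f t @[t --> 0^'+] --> inf (f @` `]0, 1]).
  apply: (@nondecreasing_at_right_cvgr _ _ _ (BRight 1)); first by rewrite bnd_simp.
    move=> s t; rewrite !in_itv/= => /andP[s0 _] /andP[_ t1] st.
    have := hC s t s0 st t1; rewrite ler_norml => /andP[+ _]; rewrite /f; nra.
  exists (- M) => _ [t /= t01 <-].
  have := hM t t01; rewrite ler_norml => /andP[+ _]; rewrite /f.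
  have : 0 <= C * t `^ q by rewrite mulr_ge0 ?powR_ge0.
  lra.
exists (inf (f @` `]0, 1]) - C * 0).
have -> : h = (fun t => f t - C * t `^ q) by apply/funext => t; rewrite /f addrK.
by apply: cvgB => //; apply: cvgM; [exact: cvg_cst|exact: powR_cvg0].
Qed.

Definition clip01 (x : R) : R := Num.max 0 (Num.min x 1).

Lemma clip01_itv x : clip01 x \in `[0, 1].
Proof. by rewrite in_itv/= /clip01; case: (ltP x 1); case: (ltP 0); lra. Qed.

Lemma clip01_id x : x \in `[0, 1] -> clip01 x = x.
Proof. by rewrite in_itv/= => /andP[x0 x1]; rewrite /clip01 min_l// max_r. Qed.

Lemma continuous_clip01 : continuous clip01.
Proof.
move=> x; apply: (@continuous_max R R (cst 0) (id \min cst 1)).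
  exact: cvg_cst.
by apply: continuous_min; [exact: cvg_id|exact: cvg_cst].
Qed.

Lemma within_continuous_clip01 (f : R -> R) : {within `[0, 1], continuous f} ->
  continuous (f \o clip01).
Proof.
move=> /subspace_continuousP cf x.
apply: (@cvg_comp _ _ _ clip01 f _ (within `[0, 1] (nbhs (clip01 x)))); last first.
  exact: cf (clip01_itv x).
move=> U /continuous_clip01 /nbhs_ballP[e /= e0 eU].
by apply/nbhs_ballP; exists e => //= y xy; apply: (eU y xy); exact: clip01_itv.
Qed.

(** As m >= 1, the first derivative exists and inherits a bound M t^p with p > -1 from the m-th one,
    so h has a limit at 0+. Composing with [clip01] makes the extension continuous on the whole
    line, so convolution integrands need no domain conditions. *)
Lemma Csigmam_continuous_extension (m : nat) h : (0 < m)%N ->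
  Csigmam m (-1) h ->
  exists2 K : R -> R, continuous K & forall t, t \in `]0, 1] -> K t = h t.
Proof.
case: m => // m _ [g /= [h' hh' h'g] /Csigma_powR_dominated dg].
have dh' := nderive_powR_dominated h'g dg.
have [l hl] := dominated_derive_cvg0 hh' dh'.
(* The limit replaces the arbitrary value of h at 0. *)
pose K0 (t : R) := if t <= 0 then l else h t.
exists (K0 \o clip01) => [|t t01]; last first.
  rewrite /= clip01_id /K0; first by rewrite leNgt; move: t01; rewrite in_itv/= => /andP[->].
  by move: t01; rewrite !in_itv/= => /andP[/ltW -> ->].
apply: within_continuous_clip01.
apply/continuous_within_itvP; first exact: ltr01.
have ch := is_derive_on_continuous hh'.
have Kh t : 0 < t -> K0 t = h t by move=> t0; rewrite /K0 leNgt t0.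
split.
- move=> x x01.
  have hx := is_derive_on_is_derive hh' x01.
  have chx : {for x, continuous h}.
    by apply: differentiable_continuous; apply/derivable1_diffP.
  have x0 : 0 < x by move: x01; rewrite in_itv/= => /andP[].
  rewrite /continuous_at Kh//.
  apply: cvg_trans chx; apply: near_eq_cvg; near=> z.
  by rewrite Kh//; near: z; exact: lt_nbhsr.
- have -> : K0 0 = l by rewrite /K0 lexx.
   apply: cvg_trans hl; apply: near_eq_cvg; near=> z.
  by rewrite Kh//; near: z; exact: nbhs_right_gt.
- rewrite (Kh 1)//.
  have /subspace_continuousP /(_ 1) := ch.
  have D1 : (`]0, 1]%classic : set R) 1 by rewrite /= in_itv/= ltr01 lexx.
  move=> /(_ D1) h1.
  have h1' : h t @[t --> 1^'-] --> h 1.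
    apply: cvg_trans h1 => U; rewrite /within/= /nbhs/= => hU.
    rewrite /at_left /within/=; near=> z => z1.
    apply: (near hU z) => //.
    rewrite /= in_itv/= (ltW z1) andbT.
    by near: z; apply: lt_nbhsr.
  apply: cvg_trans h1'; apply: near_eq_cvg; near=> z.
  by rewrite Kh//; near: z; exact: nbhs_left_gt.
Unshelve. all: by end_near. Qed.

End KernelExtension.

(** * Convolution of polynomials *)

Section BorelTransform.
Variable F : numFieldType.
Implicit Types p q : {poly F}.

(** A formal Laplace transform: t^i / i! goes to X^i, and integration from 0 becomes multiplication
    by X. *)
Definition borel p : {poly F} := \poly_(i < size p) (p`_i * i`!%:R).
Definition invborel p : {poly F} := \poly_(i < size p) (p`_i / i`!%:R).

Let fact_neq0 i : i`!%:R != 0 :> F.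
Proof. by rewrite pnatr_eq0 -lt0n fact_gt0. Qed.

Lemma coef_borel p i : (borel p)`_i = p`_i * i`!%:R.
Proof. by rewrite coef_poly; case: ltnP => // /(nth_default 0) ->; rewrite mul0r. Qed.

Lemma coef_invborel p i : (invborel p)`_i = p`_i / i`!%:R.
Proof. by rewrite coef_poly; case: ltnP => // /(nth_default 0) ->; rewrite mul0r. Qed.

Lemma invborelK : cancel invborel borel.
Proof. by move=> p; apply/polyP => i; rewrite coef_borel coef_invborel divfK. Qed.

Lemma borelK : cancel borel invborel.
Proof. by move=> p; apply/polyP => i; rewrite coef_invborel coef_borel mulfK. Qed.

Lemma borelD p q : borel (p + q) = borel p + borel q.
Proof. by apply/polyP => i; rewrite !(coefD, coef_borel) mulrDl. Qed.

Lemma borelB p q : borel (p - q) = borel p - borel q.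
Proof. by apply/polyP => i; rewrite !(coefB, coef_borel) mulrBl. Qed.

Lemma borelC c : borel c%:P = c%:P.
Proof.
by apply/polyP => i; rewrite coef_borel !coefC; case: i => [|i]/=; rewrite ?mulr1 ?mul0r.
Qed.

Lemma borelZ c p : borel (c *: p) = c *: borel p.
Proof. by apply/polyP => i; rewrite !(coefZ, coef_borel) mulrA. Qed.

(** The transform of p(x) = p(0) + \int_0^x p'. *)
Lemma borel_deriv p : borel p = (p`_0)%:P + 'X * borel p^`().
Proof.
apply/polyP => i; rewrite coefD coefC coefXM !coef_borel coef_deriv.
case: i => [|i]/=; first by rewrite mulr1 addr0.
by rewrite add0r factS natrM -[p`_i.+1 *+ _]mulr_natr mulrA.
Qed.

(* On polynomials the convolution [\int_0^x a(x - t) b(t) dt] maps the pair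
   [(t^i / i!, t^j / j!)] to [x^(i+j+1) / (i+j+1)!]. *)
Definition polyconvol p q : {poly F} := invborel ('X * (borel p * borel q)).

Lemma borel_polyconvol p q : borel (polyconvol p q) = 'X * (borel p * borel q).
Proof. exact: invborelK. Qed.

Lemma polyconvolC p q : polyconvol p q = polyconvol q p.
Proof. by rewrite /polyconvol [borel p * _]mulrC. Qed.

Lemma polyconvolA p q r :
  polyconvol p (polyconvol q r) = polyconvol (polyconvol p q) r.
Proof. by apply: (can_inj borelK); rewrite !borel_polyconvol; ring. Qed.

Lemma polyconvolBl p q r : polyconvol (p - q) r = polyconvol p r - polyconvol q r.
Proof.
by apply: (can_inj borelK); rewrite !(borel_polyconvol, borelB); ring.
Qed.

Lemma polyconvol0l p : polyconvol 0 p = 0.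
Proof. by have := polyconvolBl p p p; rewrite !subrr. Qed.

Lemma polyconvol_coef0 p q : (polyconvol p q)`_0 = 0.
Proof. by rewrite coef_invborel coefXM mul0r. Qed.

Lemma polyconvol1_deriv p : (polyconvol 1 p)^`() = p.
Proof.
apply/polyP => i; rewrite coef_deriv coef_invborel coefXM/=.
rewrite -[1]/(1%:P) borelC mul1r coef_borel factS natrM invfM.
have i1 : i.+1%:R != 0 :> F by rewrite pnatr_eq0.
rewrite -[LHS]mulr_natr; move: (fact_neq0 i) i1; move: i`!%:R i.+1%:R => u v u0 v0.
by field; rewrite u0 v0.
Qed.

(** Integration by parts, [polyconvol 1 q] being the primitive of q that vanishes at 0. *)
Lemma polyconvol_parts p q : polyconvol p q =
  p`_0 *: polyconvol 1 q + polyconvol p^`() (polyconvol 1 q).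
Proof.
apply: (can_inj borelK); rewrite borelD borelZ !borel_polyconvol.
by rewrite {1}(borel_deriv p) -[1]/(1%:P) borelC -mul_polyC; ring.
Qed.

(** The index is the exponent: the right-hand side of the Sonine condition is [monomial_kernel] at m
    - 1. *)
Definition monomial_kernel m : {poly F} := (m`!%:R)^-1 *: 'X^m.

Lemma borel_monomial_kernel m : borel (monomial_kernel m) = 'X^m.
Proof.
apply/polyP => i; rewrite coef_borel coefZ !coefXn.
by case: eqVneq => [->|_]; rewrite ?mulr1 ?mulVf// mulr0 mul0r.
Qed.

(** Under the transform, convolution with this kernel is multiplication by X^(m+1), which is
    injective. *)
Lemma polyconvol_monomial_kernel_eq0 m p :
  polyconvol (monomial_kernel m) p = 0 -> p = 0.
Proof.
move=> /(congr1 borel); rewrite borel_polyconvol borel_monomial_kernel mulrA -exprS.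
rewrite (_ : borel 0 = 0); last by rewrite -polyC0 borelC.
move/eqP; rewrite mulf_eq0 expf_eq0 polyX_eq0 andbF/= => /eqP bp0.
by apply: (can_inj borelK); rewrite bp0 -polyC0 borelC.
Qed.

Lemma polyconvol_monomial_kernel_onto m q :
  exists p, polyconvol (monomial_kernel m) p = 'X^(m.+1) * q.
Proof.
(* Convolution with X^m / m! sends X^i to i! / (i+m+1)! X^(i+m+1); the coefficients undo this
   factor. *)
pose p : {poly F} := \poly_(i < size q) (q`_i * (i + m.+1)`!%:R / i`!%:R).
exists p; apply: (can_inj borelK).
rewrite borel_polyconvol borel_monomial_kernel mulrA -exprS.
apply/polyP => i; rewrite coef_borel !coefXnM; case: ltnP => im; first by rewrite mul0r.
rewrite coef_borel coef_poly; case: ltnP => iq; last by rewrite nth_default ?mul0r.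
by rewrite divfK// subnK.
Qed.

End BorelTransform.

(** * Convolution integrals of continuous functions *)

Section Convolution.
Variable R : realType.
Notation leb := (@lebesgue_measure R).
Implicit Types (k f K F : R -> R) (x : R).

Let itv0_subset x : x \in `[0, 1] -> forall t, t \in `]0, x[ ->
  t \in `]0, 1] /\ x - t \in `]0, 1].
Proof.
rewrite in_itv/= => /andP[x0 x1] t; rewrite !in_itv/= => /andP[t0 tx].
by rewrite t0 subr_gt0 tx/=; split; lra.
Qed.

Lemma continuous_convol_integrand K F x : continuous K -> continuous F ->
  continuous (fun t => K (x - t) * F t).
Proof.
move=> cK cF t; apply: continuousM; last exact: cF.
apply: (@continuous_comp _ _ _ (fun t => x - t) K); last exact: cK.
by apply: cvgB; [exact: cvg_cst|exact: cvg_id].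
Qed.

Lemma continuous_integrable_itv F (a b : R) : continuous F ->
  leb.-integrable `[a, b] (EFin \o F).
Proof.
move=> cF; apply: continuous_compact_integrable; first exact: segment_compact.
exact: continuous_subspaceT.
Qed.

(** For 0 < t < x both t and x - t lie in (0,1]. The endpoints, where a kernel is evaluated at 0,
    form a null set. *)
Lemma eq_convol k f K F x : continuous K -> continuous F ->
  {in `]0, 1], k =1 K} -> {in `]0, 1], f =1 F} -> x \in `[0, 1] ->
  convol k f x = convol K F x.
Proof.
move=> cK cF kK fF x01.
have kf : {in `]0, x[, (fun t => k (x - t) * f t) =1 (fun t => K (x - t) * F t)}.
  by move=> t /(itv0_subset x01)[t1 t2]; rewrite kK// fF.
have mKF : measurable_fun `]0, x[ (fun t => K (x - t) * F t).
  apply: measurable_funTS.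
  apply: continuous_measurable_fun.
  exact: continuous_convol_integrand.
rewrite /convol /Rintegral; congr fine; apply: eq_integral_itv_bounded => //.
apply: eq_measurable_fun mKF => t; rewrite inE => t01.
by rewrite kf.
Qed.

Lemma convolBl K A F x : continuous K -> continuous A -> continuous F ->
  convol (K \- A) F x = convol K F x - convol A F x.
Proof.
move=> cK cA cF; rewrite /convol -RintegralB//; last 2 first.
- exact/continuous_integrable_itv/continuous_convol_integrand.
- exact/continuous_integrable_itv/continuous_convol_integrand.
by apply: eq_Rintegral => t _; rewrite /= mulrBl.
Qed.

Lemma convolBr K A F x : continuous K -> continuous A -> continuous F ->
  convol K (A \- F) x = convol K A x - convol K F x.
Proof.
move=> cK cA cF; rewrite /convol -RintegralB//; last 2 first.
- exact/continuous_integrable_itv/continuous_convol_integrand.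
- exact/continuous_integrable_itv/continuous_convol_integrand.
by apply: eq_Rintegral => t _; rewrite /= mulrBr.
Qed.

Lemma convol_bound K F (M N x : R) : continuous K -> continuous F ->
  0 <= M -> 0 <= N -> x \in `[0, 1] ->
  (forall t, t \in `]0, 1] -> `|K t| <= M) ->
  (forall t, t \in `]0, 1] -> `|F t| <= N) ->
  `|convol K F x| <= M * N.
Proof.
move=> cK cF M0 N0 x01 KM FN; have iKF := continuous_integrable_itv 0 x
  (continuous_convol_integrand (x := x) cK cF).
have [x0 x1] : 0 <= x /\ x <= 1 by move: x01; rewrite in_itv/= => /andP.
rewrite /convol (le_trans (le_normr_Rintegral _ iKF))//.
pose G t := `|K (x - t) * F t|.
have cG : continuous G.
  by move=> t; apply: cvg_norm; exact: continuous_convol_integrand.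
have mG : measurable_fun `]0, x[ (EFin \o G).
  apply/measurable_EFinP; apply: measurable_funTS.
  exact: continuous_measurable_fun.
rewrite -lee_fin fineK; last first.
  by apply: integrable_fin_num => //; exact: continuous_integrable_itv.
rewrite (@integral_itv_bndoo _ _ _ (EFin \o G))//.
apply: (@le_trans _ _ (\int[leb]_(t in `]0%R, x[) (cst (M * N)%:E t))%E).
  apply: ge0_le_integral => //.
  - by move=> t _; rewrite lee_fin normr_ge0.
  move=> t /= /(itv0_subset x01)[t1 t2].
  by rewrite lee_fin /G normrM ler_pM ?KM ?FN.
rewrite integral_cst//= lebesgue_measure_itv/= lte_fin.
case: ifPn => _; last by rewrite mule0 lee_fin mulr_ge0.
by rewrite -EFinB -EFinM lee_fin subr0 ler_piMr// mulr_ge0.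
Qed.

Lemma integral_deriv_poly (q : {poly R}) x : 0 <= x ->
  \int[leb]_(t in `[0, x]) q^`().[t] = q.[x] - q.[0].
Proof.
rewrite le_eqVlt => /predU1P[<-|x0].
  by rewrite set_itv1 Rintegral_set1 subrr.
rewrite /Rintegral (@continuous_FTC2 _ _ (horner q))//=.
- exact/continuous_subspaceT/continuous_horner.
- split=> [t _|//|//]; first exact: derivable_horner.
    by apply: cvg_at_right_filter; exact: continuous_horner.
  by apply: cvg_at_left_filter; exact: continuous_horner.
- by move=> t _; rewrite derivE.
Qed.

(** Induction on the size of a. With b1 the primitive of b vanishing at 0, the derivative in t of
    a(x - t) b1(t) is a(x - t) b(t) - a'(x - t) b1(t). Integrating leaves the boundary term a(0)
    b1(x) and a convolution with a', the same recursion as [polyconvol_parts]. *)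
Lemma convol_poly (a b : {poly R}) x : 0 <= x ->
  convol (horner a) (horner b) x = (polyconvol a b).[x].
Proof.
move=> x0; have [n] := ubnPleq (size a); elim: n a b => [|n IH] a b an.
  move: an; rewrite leqn0 size_poly_eq0 => /eqP ->.
  rewrite polyconvol0l horner0 /convol.
  under eq_Rintegral do rewrite horner0 mul0r.
  by rewrite Rintegral_cst// mul0r.
pose b1 := polyconvol 1 b.
pose q := (a \Po (x%:P - 'X)) * b1.
have q' : q^`() = (a \Po (x%:P - 'X)) * b - (a^`() \Po (x%:P - 'X)) * b1.
  rewrite derivM deriv_comp polyconvol1_deriv derivB derivC derivX sub0r mulrN1.
  by rewrite mulNr addrC.
have b10 : b1.[0] = 0 by rewrite horner_coef0 polyconvol_coef0.
have h1 : convol (horner a) (horner b) x =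
    \int[leb]_(t in `[0, x]) q^`().[t] + convol (horner a^`()) (horner b1) x.
  rewrite /convol -RintegralD//; last 2 first.
  - exact/continuous_integrable_itv/continuous_horner.
  - apply/continuous_integrable_itv/continuous_convol_integrand;
    exact: continuous_horner.
  apply: eq_Rintegral => t _.
  by rewrite q' !(hornerE, horner_comp) subrK.
rewrite h1 integral_deriv_poly// /q !hornerM !horner_comp b10 mulr0 subr0.
rewrite !hornerE subrr horner_coef0 polyconvol_parts !hornerE.
rewrite IH//; have [->|a0] := eqVneq a 0; first by rewrite deriv0 size_poly0.
by rewrite -ltnS (leq_trans _ an)// lt_size_deriv.
Qed.

End Convolution.

(** * Uniform approximation of convolutions *)

Section SonineApproximation.
Variable R : realType.
Notation leb := (@lebesgue_measure R).

Lemma small_factor (D e : R) : 0 <= D -> 0 < e ->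
  exists d : R, [/\ 0 < d, d <= 1 & D * d <= e].
Proof.
move=> D0 e0; have D1 : 0 < D + 1 by rewrite ltr_wpDl.
(* Dividing by D + 1 rather than D covers D = 0. *)
exists (Num.min 1 (e / (D + 1))); split.
- by rewrite lt_min ltr01 divr_gt0.
- by rewrite ge_min lexx.
- have : D * Num.min 1 (e / (D + 1)) <= D * (e / (D + 1)).
    by rewrite ler_wpM2l// ge_min lexx orbT.
  move/le_trans; apply; rewrite mulrA ler_pdivrMr// mulrC ler_wpM2l ?lerDl//.
  exact: ltW.
Qed.

(** Otherwise a nondegenerate interval near x, cut down to [0,1], would lie in the exceptional null
    set. *)
Lemma ae_dense_unit_interval (P : R -> Prop) :
  {ae leb, forall x, x \in `[0, 1] -> P x} ->
  forall x e : R, x \in `[0, 1] -> 0 < e ->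
  exists y, [/\ y \in `[0, 1], `|x - y| < e & P y].
Proof.
move=> [N [mN N0 PN]] x e; rewrite in_itv/= => /andP[x0 x1] e0.
apply: contrapT => nP.
pose a := Num.max 0 (x - e); pose b := Num.min 1 (x + e).
have ab : a < b by rewrite /a /b lt_min !gt_max; lra.
have abN : `]a, b[ `<=` N.
  move=> y; rewrite /= in_itv/= /a /b gt_max lt_min => /andP[/andP[y0 xy] /andP[y1 yx]].
  apply: PN => /= yP; apply: nP; exists y; split.
  - by rewrite in_itv/= !ltW.
  - by rewrite ltr_distl; lra.
  - by apply: yP; rewrite in_itv/= !ltW.
have : (leb (`]a, b[%classic : set R) <= 0)%E.
  by rewrite -N0; apply: le_measure; rewrite ?inE.
rewrite lebesgue_measure_itv/= lte_fin ab -EFinB lee_fin; lra.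
Qed.

Lemma ae_le_horner (q : {poly R}) (M : R) :
  {ae leb, forall x, x \in `[0, 1] -> `|q.[x]| <= M} ->
  forall x : R, x \in `[0, 1] -> `|q.[x]| <= M.
Proof.
move=> qM x x01; rewrite leNgt; apply/negP => Mq.
have /cvgrPdist_lt /(_ (`|q.[x]| - M)) := @continuous_horner _ q x.
rewrite subr_gt0 => /(_ Mq)/nbhs_ballP[d /= d0 dq].
have [y [y01 xy qy]] := ae_dense_unit_interval qM x01 d0.
have := dq y xy; have := ler_distD q.[y] 0 q.[x].
by rewrite !sub0r !normrN (distrC q.[y]) /=; lra.
Qed.

Lemma horner_eq0_unit_interval (q : {poly R}) :
  (forall x, x \in `[0, 1] -> q.[x] = 0) -> q = 0.
Proof.
move=> q0; apply/eqP/negPn/negP => qn0.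
(* The points 1 / (i + 1) are [size q] distinct roots in [0,1], one more than the degree allows. *)
pose rs := [seq (i.+1%:R : R)^-1 | i <- iota 0 (size q)].
have : (size rs < size q)%N.
  apply: max_poly_roots => //.
    apply/allP => _ /mapP[i _ ->]; apply/rootP/q0.
    by rewrite in_itv/= invr_ge0 ler0n/= invf_le1 ?ler1n.
  rewrite map_inj_uniq ?iota_uniq// => i j /invr_inj /eqP.
  by rewrite eqr_nat eqSS => /eqP.
by rewrite size_map size_iota ltnn.
Qed.

Lemma bounded_horner (q : {poly R}) :
  exists2 M : R, 0 <= M & forall x, x \in `[0, 1] -> `|q.[x]| <= M.
Proof. by apply: bounded_on_unit_interval => x _; exact: continuous_horner. Qed.

Let oc_cc (x : R) : x \in `]0, 1] -> x \in `[0, 1].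
Proof. by rewrite !in_itv/= => /andP[/ltW ->]. Qed.

Lemma convol_poly_uniform (L : R -> R) (p : {poly R}) (e : R) : continuous L ->
  0 < e -> exists q : {poly R}, forall x, x \in `[0, 1] ->
    `|convol L (horner p) x - q.[x]| <= e.
Proof.
move=> cL e0; have [N N0 pN] := bounded_horner p.
have [d [d0 _ Nd]] := small_factor N0 e0.
have [b Lb] : exists b : {poly R}, forall x, x \in `[0, 1] -> `|L x - b.[x]| <= d.
  by apply: weierstrass => // x _; exact: cL.
exists (polyconvol b p) => x x01.
have x0 : 0 <= x by move: x01; rewrite in_itv => /andP[].
have cp := @continuous_horner R p; have cb := @continuous_horner R b.
rewrite -convol_poly// -convolBl// (le_trans _ Nd)// mulrC.
apply: convol_bound => //; [|exact: ltW| |].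
- by move=> t; apply: cvgB; [exact: cL|exact: cb].
- by move=> t /oc_cc; exact: Lb.
- by move=> t /oc_cc; exact: pN.
Qed.

(** A uniform limit of polynomials is continuous. *)
Lemma continuous_convol_horner (L : R -> R) (p : {poly R}) : continuous L ->
  {within `[0, 1], continuous (convol L (horner p))}.
Proof.
move=> cL; apply/subspace_continuousP => x x01.
apply/cvgrPdist_lt => e e0; rewrite near_withinE.
have e3 : 0 < e / 3 by rewrite divr_gt0.
have [q Lq] := convol_poly_uniform p cL e3.
have /cvgrPdist_lt /(_ _ e3) := @continuous_horner R q x.
apply: filterS => y xy y01.
have := Lq x x01; have := Lq y y01; move: xy.
set u := convol L _ x; set v := convol L _ y.
have := ler_distD q.[x] u v; have := ler_distD q.[y] q.[x] v.
rewrite (distrC v) /=; lra.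
Qed.

Variables (K L : R -> R) (m : nat).
Hypotheses (cK : continuous K) (cL : continuous L).
Hypothesis KL : forall x, x \in `]0, 1] ->
  convol K L x = (monomial_kernel R m).[x].

(** Split a * b - K * L as (a - K) * b + K * (b - L): the two terms are at most d (NL + 1) and NK d.
    The constant C precedes d, so later errors can be made small by choosing d last. *)
Lemma sonine_poly_approx : exists2 C : R, 0 <= C &
  forall d : R, 0 < d -> d <= 1 -> exists a b : {poly R},
  [/\ forall x, x \in `[0, 1] -> `|L x - b.[x]| <= d,
      forall x, x \in `[0, 1] -> `|a.[x]| <= C &
      forall x, x \in `]0, 1] ->
        `|(polyconvol a b - monomial_kernel R m).[x]| <= C * d].
Proof.
have [NK NK0 KN] : exists2 M : R, 0 <= M & forall x, x \in `[0, 1] -> `|K x| <= M.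
  by apply: bounded_on_unit_interval => x _; exact: cK.
have [NL NL0 LN] : exists2 M : R, 0 <= M & forall x, x \in `[0, 1] -> `|L x| <= M.
  by apply: bounded_on_unit_interval => x _; exact: cL.
exists (NK + NL + 1) => [|d d0 d1]; first by rewrite !addr_ge0.
have [a Ka] : exists a : {poly R}, forall x, x \in `[0, 1] -> `|K x - a.[x]| <= d.
  by apply: weierstrass => // x _; exact: cK.
have [b Lb] : exists b : {poly R}, forall x, x \in `[0, 1] -> `|L x - b.[x]| <= d.
  by apply: weierstrass => // x _; exact: cL.
have ca := @continuous_horner R a; have cb := @continuous_horner R b.
have bN x : x \in `[0, 1] -> `|b.[x]| <= NL + 1.
  move=> x01; have := LN x x01; have := Lb x x01.
  have := ler_distD (L x) 0 b.[x]; rewrite !sub0r !normrN; lra.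
exists a, b; split => // [x x01|x x01].
  have := KN x x01; have := Ka x x01.
  have := ler_distD (K x) 0 a.[x]; rewrite !sub0r !normrN; lra.
have x01' := oc_cc x01.
have x0 : 0 <= x by move: x01'; rewrite in_itv => /andP[].
rewrite hornerD hornerN -convol_poly// -KL//.
have caK : continuous (horner a \- K).
  by move=> t; apply: cvgB; [exact: ca|exact: cK].
have cbL : continuous (horner b \- L).
  by move=> t; apply: cvgB; [exact: cb|exact: cL].
have h1 : `|convol (horner a \- K) (horner b) x| <= d * (NL + 1).
  apply: convol_bound => //; [exact: ltW|by rewrite addr_ge0| |].
    by move=> t /oc_cc t01; rewrite /= distrC Ka.
  by move=> t /oc_cc; exact: bN.
have h2 : `|convol K (horner b \- L) x| <= NK * d.
  apply: convol_bound => //; [exact: ltW| |].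
    by move=> t /oc_cc; exact: KN.
  by move=> t /oc_cc t01; rewrite /= distrC Lb.
move: h1 h2; rewrite convolBl// convolBr//.
set u := convol (horner a) (horner b) x; set v := convol K (horner b) x.
by set w := convol K L x; have := ler_distD v u w; lra.
Qed.

Lemma sonine_convol_approx (r : {poly R}) (e : R) : 0 < e ->
  exists p : {poly R}, forall x, x \in `[0, 1] ->
    `|convol L (horner p) x - (polyconvol (monomial_kernel R m) r).[x]| <= e.
Proof.
move=> e0; have [C C0 approx] := sonine_poly_approx.
have [N N0 rN] := bounded_horner r.
(* The error is (L - b) * p + (a * b - e_m) * r with p = a * r, and each term is at most C N d. *)
have D0 : 0 <= 2 * (C * N) by rewrite !mulr_ge0.
have [d [d0 d1 De]] := small_factor D0 e0.
have [a [b [Lb aC abC]]] := approx d d0 d1.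
have ca := @continuous_horner R a; have cb := @continuous_horner R b.
have cr := @continuous_horner R r.
pose p := polyconvol a r; have cp := @continuous_horner R p.
exists p => x x01; have x0 : 0 <= x by move: x01; rewrite in_itv => /andP[].
have pCN y : y \in `]0, 1] -> `|p.[y]| <= C * N.
  move=> /oc_cc y01; rewrite -convol_poly; last by move: y01; rewrite in_itv => /andP[].
  by apply: convol_bound => // t /oc_cc; [exact: aC|exact: rN].
have h1 : `|convol (L \- horner b) (horner p) x| <= d * (C * N).
  apply: convol_bound => //; [|exact: ltW|by rewrite mulr_ge0|].
    by move=> t; apply: cvgB; [exact: cL|exact: cb].
  by move=> t /oc_cc; exact: Lb.
have h2 : `|convol (horner (polyconvol a b - monomial_kernel R m)) (horner r) x| <= C * d * N.
  apply: convol_bound => //; [exact: continuous_horner|by rewrite mulr_ge0// ltW|].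
  by move=> t /oc_cc; exact: rN.
move: h1 h2; rewrite convolBl// !convol_poly// polyconvolBl.
rewrite /p polyconvolA (polyconvolC b a) hornerD hornerN.
set u := convol L _ x; set v := (polyconvol (polyconvol a b) r).[x].
by set w := (polyconvol _ r).[x]; have := ler_distD v u w; lra.
Qed.

Lemma sonine_convol_ae_eq0 (p : {poly R}) :
  {ae leb, forall x, x \in `[0, 1] -> convol L (horner p) x = 0} -> p = 0.
Proof.
move=> Lp0; apply: (@polyconvol_monomial_kernel_eq0 _ m).
apply: horner_eq0_unit_interval => x x01; apply/eqP; rewrite -normr_le0.
apply/ler_addgt0Pl => e e0; rewrite addr0.
have [C C0 approx] := sonine_poly_approx.
have [N N0 pN] := bounded_horner p.
have D0 : 0 <= 2 * (C * N) by rewrite !mulr_ge0.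
have [d [d0 d1 De]] := small_factor D0 e0.
have [a [b [Lb aC abC]]] := approx d d0 d1.
have ca := @continuous_horner R a; have cb := @continuous_horner R b.
have cp := @continuous_horner R p.
have x0 : 0 <= x by move: x01; rewrite in_itv => /andP[].
(* Almost everywhere b * p equals (b - L) * p, which is small; being a polynomial, b * p then
   satisfies the bound at every point. *)
have bp y : y \in `[0, 1] -> `|(polyconvol b p).[y]| <= d * N.
  apply: ae_le_horner.
  apply: (@filterS _ _ (ae_filter_ringOfSetsType leb)) Lp0.
  move=> z /[swap] z01 /(_ z01) Lz.
  have z0 : 0 <= z by move: z01; rewrite in_itv => /andP[].
  rewrite -convol_poly// -[X in `|X|]subr0 -Lz -convolBl//.
  apply: convol_bound => //; [|exact: ltW| |].
  - by move=> t; apply: cvgB; [exact: cb|exact: cL].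
  - by move=> t /oc_cc t01; rewrite /= distrC Lb.
  - by move=> t /oc_cc; exact: pN.
have h1 : `|(polyconvol a (polyconvol b p)).[x]| <= C * (d * N).
  rewrite -convol_poly//; apply: convol_bound => //.
  - exact: continuous_horner.
  - by rewrite mulr_ge0// ltW.
  - by move=> t /oc_cc; exact: aC.
  - by move=> t /oc_cc; exact: bp.
have h2 : `|convol (horner (polyconvol a b - monomial_kernel R m)) (horner p) x| <= C * d * N.
  apply: convol_bound => //; [exact: continuous_horner|by rewrite mulr_ge0// ltW|].
  by move=> t /oc_cc; exact: pN.
move: h1 h2; rewrite convol_poly// polyconvolBl polyconvolA hornerD hornerN.
set v := (polyconvol (polyconvol a b) p).[x].
set w := (polyconvol _ p).[x]; have := ler_distD v 0 w; rewrite !sub0r !normrN.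
lra.
Qed.

End SonineApproximation.

(** * Weighted L2 space *)

Section JacobiWeight.
Variable R : realType.
Notation leb := (@lebesgue_measure R).

(** On each compact subinterval the fundamental theorem bounds the integral by 2 B; monotone
    convergence along an exhaustion of (0,1) concludes. *)
Lemma integrable_bounded_primitive (f F : R -> R) (B : R) :
  {in `]0, 1[, continuous f} -> {in `]0, 1[, forall x : R, 0 <= f x} ->
  {in `]0, 1[, forall x : R, is_derive x 1 F (f x)} ->
  {in `]0, 1[, forall x : R, `|F x| <= B} ->
  leb.-integrable `]0, 1[ (EFin \o f).
Proof.
move=> cf f0 fF FB.
have mf : measurable_fun (`]0, 1[%classic : set R) f.
  apply: open_continuous_measurable_fun; first exact: interval_open.
  by move=> x; rewrite inE; exact: cf.
(* Starting at 1/3 keeps a n < 1 - a n for every n. *)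
pose a n : R := n.+3%:R^-1.
have a0 n : 0 < a n by rewrite invr_gt0.
have a13 n : a n <= 3^-1 by rewrite lef_pV2 ?posrE// ler_nat.
pose I n : set R := `[a n, 1 - a n]%classic.
have sub n : I n `<=` (`]0, 1[%classic : set R).
  by move=> x; rewrite /I /= !in_itv/= => /andP[ax xa]; have := a0 n; lra.
have bigI : \bigcup_n I n = (`]0, 1[%classic : set R).
  apply/seteqP; split=> [x [n _]|x]; first exact: sub.
  rewrite /= in_itv/= => /andP[x0 x1].
  have m0 : 0 < Num.min x (1 - x) by rewrite lt_min x0 subr_gt0.
  exists (Num.truncn (Num.min x (1 - x))^-1) => //.
  have : a (Num.truncn (Num.min x (1 - x))^-1) <= Num.min x (1 - x).
    rewrite /a -[leRHS]invrK lef_pV2 ?posrE ?invr_gt0//.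
    apply: (le_trans (ltW (truncnS_gt _))).
    by rewrite ler_nat; do 2 apply: leqW.
  by rewrite le_min /I /= in_itv/= => /andP[-> ?]; lra.
apply/integrableP; split; first exact/measurable_EFinP.
have -> : (\int[leb]_(x in `]0%R, 1%R[) `|(EFin \o f) x| =
    \int[leb]_(x in \bigcup_n I n) (f x)%:E)%E.
  rewrite bigI; apply: eq_integral => x; rewrite inE => x01.
  by rewrite /= ger0_norm// f0.
have ndI : nondecreasing_seq I.
  move=> i j ij; apply/subsetPset => x; rewrite /I /= !in_itv/= => /andP[ix xi].
  have : a j <= a i by rewrite lef_pV2 ?posrE// ler_nat !ltnS.
  by lra.
have mI i : measurable (I i) by exact: measurable_itv.
have mfI i : measurable_fun (I i) (EFin \o f).
  by apply/measurable_EFinP; exact: measurable_funS mf.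
have f0I i x : I i x -> (0 <= (f x)%:E)%E by move=> /sub x01; rewrite lee_fin f0.
have cvgI : ((\int[leb]_(x in I i) (f x)%:E)%E @[i --> \oo] -->
    (\int[leb]_(x in \bigcup_i I i) (f x)%:E)%E).
  exact: ge0_nondecreasing_set_cvg_integral.
rewrite -(cvg_lim _ cvgI)//.
apply: (@le_lt_trans _ _ (B + B)%:E); last exact: ltry.
apply: lime_le; first by apply/cvg_ex; eexists; exact: cvgI.
apply: nearW => n.
have an : a n < 1 - a n by have := a13 n; lra.
have an01 : a n \in `]0, 1[ by apply: (sub n); rewrite /I /= in_itv/= lexx ltW.
have bn01 : 1 - a n \in `]0, 1[ by apply: (sub n); rewrite /I /= in_itv/= lexx ltW.
have cF x : x \in `]0, 1[ -> {for x, continuous F}.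
  by move=> /fF dF; apply/differentiable_continuous/derivable1_diffP.
rewrite (@continuous_FTC2 _ f F)//.
- rewrite -EFinB lee_fin (le_trans (ler_norm _))// (le_trans (ler_normB _ _))//.
  by rewrite lerD ?FB.
- by apply: continuous_in_subspaceT => x; rewrite inE => /sub; exact: cf.
- split => [x xab| |].
  + have x01 : x \in `]0, 1[.
      by apply: (sub n); move: xab; rewrite /I /= !in_itv/= => /andP[/ltW -> /ltW ->].
    by have := fF x x01.
  + by apply: cvg_at_right_filter; exact: cF.
  + by apply: cvg_at_left_filter; exact: cF.
- move=> x xab; rewrite derive1E.
  have x01 : x \in `]0, 1[.
    by apply: (sub n); move: xab; rewrite /I /= !in_itv/= => /andP[/ltW -> /ltW ->].
  by have dF := fF x x01; rewrite derive_val.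
Qed.

Lemma continuous_powR_comp (g : R -> R) (p x : R) : {for x, continuous g} ->
  0 < g x -> {for x, continuous (fun y => g y `^ p)}.
Proof.
move=> cg g0; apply: (@continuous_comp _ _ _ g (@powR R ^~ p)) => //.
apply/differentiable_continuous/derivable1_diffP.
by apply: derivable_powR; rewrite in_itv/= andbT.
Qed.

(** The primitive (c x + d)^(p+1) / (c (p+1)) is bounded, as p + 1 > 0 and the base is at most 2. *)
Lemma integrable_powR_affine (c d p : R) : -1 < p -> c != 0 ->
  (forall x, x \in `]0, 1[ -> 0 < c * x + d <= 2) ->
  leb.-integrable `]0, 1[ (EFin \o (fun x => (c * x + d) `^ p)).
Proof.
move=> p1 c0 cd; have q0 : 0 < p + 1 by rewrite -ltrBlDr sub0r.
have dl (x : R) : is_derive x (1 : R) (fun x => c * x + d) c.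
  have := is_derive_poly (c *: 'X + d%:P) x.
  rewrite derivD derivZ derivX derivC addr0 hornerZ hornerC mulr1.
  by have -> : horner (c *: 'X + d%:P) = (fun x => c * x + d)
    by apply/funext => y; rewrite !hornerE.
pose F (x : R) := (c * (p + 1))^-1 * (c * x + d) `^ (p + 1).
apply: (@integrable_bounded_primitive _ F (`|(c * (p + 1))^-1| * 2 `^ (p + 1))).
- move=> x x01; have /andP[cx _] := cd x x01.
  apply: (@continuous_powR_comp (fun x => c * x + d)) => //.
  by apply: differentiable_continuous; apply/derivable1_diffP.
- by move=> x _; exact: powR_ge0.
- move=> x x01; have /andP[cx _] := cd x x01.
  have dp := is_derive1_powR (p + 1) cx.
  have dc : is_derive x (1 : R) ((@powR R ^~ (p + 1)) \o (fun x => c * x + d))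
      (((p + 1) * (c * x + d) `^ (p + 1 - 1)) * c).
    exact: (@is_derive1_comp R (@powR R ^~ (p + 1)) (fun x => c * x + d) x _ _ dp (dl x)).
  have := is_deriveZ ((c * (p + 1))^-1) dc.
  rewrite addrK => dF; rewrite (_ : (c * x + d) `^ p = (c * (p + 1))^-1 *:
    (((p + 1) * (c * x + d) `^ p) * c)) //.
  by rewrite /GRing.scale/=; field; rewrite c0 gt_eqF.
- move=> x x01; have /andP[cx cx2] := cd x x01.
  rewrite /F normrM ler_wpM2l// ger0_norm ?powR_ge0//.
  by apply: ge0_ler_powR => //; rewrite ?nnegrE// ltW.
Qed.

Variables (alpha beta : R).
Hypotheses (alpha1 : -1 < alpha) (beta1 : -1 < beta).
Let w := jacobi_weight alpha beta.

Lemma jacobi_weight_ge0 x : 0 <= w x.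
Proof. by rewrite mulr_ge0 ?powR_ge0. Qed.

Lemma jacobi_weight_gt0 x : x \in `]0, 1[ -> 0 < w x.
Proof.
by rewrite in_itv/= => /andP[x0 x1]; rewrite mulr_gt0 ?powR_gt0//; lra.
Qed.

Lemma jacobi_weight_continuous : {in `]0, 1[, continuous w}.
Proof.
move=> x; rewrite in_itv/= => /andP[x0 x1]; apply: cvgM.
- apply: (@continuous_powR_comp (fun x => 2 - 2 * x) alpha x); last by lra.
  by apply: cvgB; [exact: cvg_cst|apply: cvgM; [exact: cvg_cst|exact: cvg_id]].
- apply: (@continuous_powR_comp (fun x => 2 * x) beta x); last by lra.
  by apply: cvgM; [exact: cvg_cst|exact: cvg_id].
Qed.

Lemma measurable_jacobi_weight : measurable_fun setT w.
Proof.
apply: measurable_funM.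
  apply: (measurableT_comp (@measurable_powR R alpha)).
  apply: continuous_measurable_fun => x.
  by apply: cvgB; [exact: cvg_cst|apply: cvgM; [exact: cvg_cst|exact: cvg_id]].
apply: (measurableT_comp (@measurable_powR R beta)).
apply: continuous_measurable_fun => x.
by apply: cvgM; [exact: cvg_cst|exact: cvg_id].
Qed.

Lemma powR_le_1_2 (y p : R) : 1 <= y <= 2 -> y `^ p <= 1 + 2 `^ p.
Proof.
move=> /andP[y1 y2]; have [p0|p0] := leP 0 p.
  rewrite (@le_trans _ _ (2 `^ p))// ?lerDr//.
  by apply: ge0_ler_powR; rewrite ?nnegrE// (le_trans _ y1).
have y1' : y `^ p <= 1 by rewrite -(powRr0 y); apply: ler_powR => //; exact: ltW.
by rewrite (le_trans y1')// lerDl powR_ge0.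
Qed.

(** On each half of the interval the factor without singularity has its base in [1,2] and is bounded
    by A or B, so w is dominated by A (2x)^beta + B (2-2x)^alpha. *)
Lemma integrable_jacobi_weight : leb.-integrable `]0, 1[ (EFin \o w).
Proof.
have ia : leb.-integrable `]0, 1[ (EFin \o (fun x => ((-2) * x + 2) `^ alpha)).
  apply: integrable_powR_affine => // x.
  by rewrite in_itv/= => /andP[x0 x1]; lra.
have ib : leb.-integrable `]0, 1[ (EFin \o (fun x => (2 * x + 0) `^ beta)).
  apply: integrable_powR_affine => // x.
  by rewrite in_itv/= => /andP[x0 x1]; lra.
pose A := 1 + 2 `^ alpha; pose B := 1 + 2 `^ beta.
have A0 : 0 <= A by rewrite addr_ge0 ?powR_ge0.
have B0 : 0 <= B by rewrite addr_ge0 ?powR_ge0.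
have iAB : leb.-integrable `]0, 1[ (fun x =>
    A%:E * ((2 * x + 0) `^ beta)%:E + B%:E * (((-2) * x + 2) `^ alpha)%:E)%E.
  by apply: integrableD => //; apply: integrableZl.
apply: le_integrable iAB => //.
  by apply/measurable_EFinP; apply: measurable_funTS; exact: measurable_jacobi_weight.
move=> x; rewrite /= in_itv/= => /andP[x0 x1].
rewrite lee_fin (ger0_norm (jacobi_weight_ge0 _)) addr0.
rewrite (_ : (-2) * x + 2 = 2 - 2 * x); last by ring.
rewrite ger0_norm ?addr_ge0 ?mulr_ge0 ?powR_ge0// /w /jacobi_weight.
have [x2|x2] := leP x 2^-1.
  rewrite ler_wpDr ?mulr_ge0 ?powR_ge0// ler_wpM2r ?powR_ge0//.
  by apply: powR_le_1_2; lra.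
rewrite ler_wpDl ?mulr_ge0 ?powR_ge0// mulrC ler_wpM2r ?powR_ge0//.
by apply: powR_le_1_2; lra.
Qed.

End JacobiWeight.

(** * Density of the polynomial multiples of X^m in the weighted space *)

Section WeightedDensity.
Variable R : realType.
Notation leb := (@lebesgue_measure R).

Definition clip (M y : R) : R := Num.max (- M) (Num.min y M).

Lemma clipP (M y : R) : 0 <= M ->
  [\/ y < - M /\ clip M y = - M, - M <= y <= M /\ clip M y = y
    | M < y /\ clip M y = M].
Proof.
move=> M0; rewrite /clip; have [yM|My] := leP y M.
  have [My|yM'] := leP (- M) y.
    by apply: Or32.
  by apply: Or31.
by apply: Or33; rewrite max_r//; lra.
Qed.

Lemma clip_bound (M y : R) : 0 <= M -> `|clip M y| <= M.
Proof. by move=> M0; rewrite ler_norml; case: (clipP y M0) => -[h ->]; lra. Qed.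

Lemma clip_lipschitz (M y z : R) : 0 <= M -> `|clip M y - clip M z| <= `|y - z|.
Proof.
move=> M0; have := ler_norm (y - z); have := ler_norm (z - y).
rewrite (distrC z y) ler_norml; move: `|y - z| => d.
by case: (clipP y M0) => -[h ->]; case: (clipP z M0) => -[h' ->]; lra.
Qed.

Lemma clip_id (M y : R) : `|y| <= M -> clip M y = y.
Proof.
move=> yM; have M0 : 0 <= M := le_trans (normr_ge0 _) yM.
by move: yM; rewrite ler_norml; case: (clipP y M0) => -[h ->]; lra.
Qed.

Lemma continuous_clip (M : R) : continuous (clip M).
Proof.
move=> x; apply: (@continuous_max R R (cst (- M)) (id \min cst M)).
  exact: cvg_cst.
by apply: continuous_min; [exact: cvg_id|exact: cvg_cst].
Qed.

(** The number a [clip M y] lies between 0 and y. This provides the dominating function in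
    [wint_truncation]. *)
Lemma sqr_sub_clip (M a y : R) : 0 <= M -> 0 <= a <= 1 ->
  (y - a * clip M y) ^+ 2 <= y ^+ 2.
Proof.
move=> M0 a01; have [y0|y0] := leP 0 y.
  have c : 0 <= clip M y <= y by case: (clipP y M0) => -[h ->]; lra.
  by rewrite lerXn2r ?nnegrE//; nra.
have c : y <= clip M y <= 0 by case: (clipP y M0) => -[h ->]; lra.
by rewrite -(sqrrN y) -sqrrN lerXn2r ?nnegrE//; nra.
Qed.

(** A continuous cutoff: it is 0 where n x (1 - x) <= 1, in particular near 0 and 1 and outside
    [0,1], and 1 where n x (1 - x) >= 2. Hence it tends to 1 pointwise on (0,1). *)
Definition cutoff (n : nat) (x : R) : R := clip01 (n%:R * (x * (1 - x)) - 1).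

Lemma cutoff_itv n x : 0 <= cutoff n x <= 1.
Proof. by have := clip01_itv (n%:R * (x * (1 - x)) - 1); rewrite in_itv. Qed.

Lemma continuous_cutoff n : continuous (cutoff n).
Proof.
have -> : cutoff n = clip01 (R := R) \o horner (n%:R *: ('X * (1 - 'X)) - 1).
  by apply/funext => y; rewrite /cutoff /= !hornerE.
move=> x; apply: continuous_comp; first exact: continuous_horner.
exact: continuous_clip01.
Qed.

Lemma cutoff_eq0 n x : n%:R * (x * (1 - x)) <= 1 -> cutoff n x = 0.
Proof.
by move=> h; rewrite /cutoff /clip01 max_l// ge_min subr_le0 h.
Qed.

Lemma cutoff_eq1 n x : 2 <= n%:R * (x * (1 - x)) -> cutoff n x = 1.
Proof.
by move=> h; rewrite /cutoff /clip01 min_r ?max_r// lerBrDl.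
Qed.

Variable w : R -> R.
Hypothesis w_ge0 : forall x, 0 <= w x.
Hypothesis w_gt0 : forall x, x \in `]0, 1[ -> 0 < w x.
Hypothesis w_cont : {in `]0, 1[, continuous w}.
Hypothesis w_int : leb.-integrable `]0, 1[ (EFin \o w).

Local Notation D := (`]0%R, 1%R[%classic : set R).

(** The squared norm, taken over the open interval, where w is continuous and positive, and with
    extended real values, so that it makes sense before finiteness is known. *)
Definition wint (u : R -> R) : \bar R :=
  (\int[leb]_(x in `]0%R, 1%R[) (u x ^+ 2 * w x)%:E)%E.

Let mw : measurable_fun D w.
Proof. by case/integrableP : w_int => /measurable_EFinP. Qed.

Let msq (u : R -> R) : measurable_fun D u ->
  measurable_fun D (fun x => (u x ^+ 2 * w x)%:E).
Proof.
by move=> mu; apply/measurable_EFinP; apply: measurable_funM => //; exact: measurable_funX.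
Qed.

(** From (u + v)^2 <= 2 u^2 + 2 v^2, in place of Minkowski's inequality. *)
Lemma wint_add (u v : R -> R) (a b : R) : measurable_fun D u -> measurable_fun D v ->
  (wint u <= a%:E)%E -> (wint v <= b%:E)%E ->
  (wint (u \+ v)%R <= (2 * a + 2 * b)%:E)%E.
Proof.
move=> mu mv ua vb.
have sq0 (u' : R -> R) x : (0%R <= (u' x ^+ 2 * w x)%:E)%E.
  by rewrite lee_fin mulr_ge0 ?sqr_ge0.
apply: (@le_trans _ _ (\int[leb]_(x in `]0%R, 1%R[)
    (2%:E * (u x ^+ 2 * w x)%:E + 2%:E * (v x ^+ 2 * w x)%:E))%E).
  apply: ge0_le_integral => //.
  - by apply: msq; exact: measurable_funD.
  - by apply: emeasurable_funD; apply: measurable_funeM; exact: msq.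
  move=> x _; rewrite -!EFinM -EFinD lee_fin /= !mulrA -mulrDl ler_wpM2r//.
  by have := sqr_ge0 (u x - v x); nra.
rewrite ge0_integralD//=; last 4 first.
- by move=> x _; rewrite mule_ge0.
- by apply: measurable_funeM; exact: msq.
- by move=> x _; rewrite mule_ge0.
- by apply: measurable_funeM; exact: msq.
rewrite !ge0_integralZl_EFin//; [|exact: msq..].
rewrite (_ : (2 * a + 2 * b)%:E = (2%:E * a%:E + 2%:E * b%:E)%E)//.
by rewrite leeD// lee_pmul2l// lte_fin.
Qed.

(** Turns uniform bounds into norm bounds; W is the total mass of w. *)
Lemma wint_sup : exists2 W : R, 0 <= W & forall (u : R -> R) (d : R),
  measurable_fun D u -> (forall x, x \in `]0, 1[ -> `|u x| <= d) ->
  (wint u <= (d ^+ 2 * W)%:E)%E.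
Proof.
pose W := fine (\int[leb]_(x in `]0%R, 1%R[) (w x)%:E)%E.
have WE : (\int[leb]_(x in `]0%R, 1%R[) (w x)%:E)%E = W%:E.
  by rewrite /W fineK//; apply: integrable_fin_num.
exists W => [|u d mu ud].
  by rewrite -lee_fin -WE integral_ge0// => x _; rewrite lee_fin.
rewrite EFinM -WE -ge0_integralZl_EFin//; last 3 first.
- by move=> x _; rewrite lee_fin.
- exact/measurable_EFinP.
- exact: sqr_ge0.
apply: ge0_le_integral => //.
- by move=> x _; rewrite lee_fin mulr_ge0 ?sqr_ge0.
- exact: msq.
- by apply: measurable_funeM; exact/measurable_EFinP.
move=> x x01; rewrite -EFinM lee_fin ler_wpM2r//.
have dx := ud x x01; rewrite -real_normK ?num_real// lerXn2r ?nnegrE//.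
exact: le_trans dx.
Qed.

Lemma ereal_cvg0_lt (s : nat -> \bar R) (e : R) : s @ \oo --> 0%E -> 0 < e ->
  exists n, (s n < e%:E)%E.
Proof.
move=> /fine_cvgP[sfin /cvgrPdist_lt s0] e0.
have : \forall n \near \oo, (s n < e%:E)%E.
  near=> n; have sn : s n \is a fin_num by near: n.
  rewrite -(fineK sn) lte_fin (le_lt_trans (ler_norm _))//.
  rewrite -normrN -sub0r; near: n; exact: s0.
by move=> [n _ /(_ n (leqnn n))]; exists n.
Unshelve. all: by end_near. Qed.

(** Dominated convergence under f^2 w: at each point of (0,1) the truncation equals f for all large
    n. *)
Lemma wint_truncation (f : R -> R) (e : R) : measurable_fun D f -> (wint f < +oo)%E -> 0 < e ->
  exists n, (wint (fun x => f x - cutoff n x * clip n.+1%:R (f x))%R < e%:E)%E.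
Proof.
move=> mf foo e0.
have mfn n : measurable_fun D (fun x => f x - cutoff n x * clip n.+1%:R (f x)).
  apply: measurable_funB => //; apply: measurable_funM.
    apply: measurable_funTS; apply: continuous_measurable_fun.
    exact: continuous_cutoff.
  apply: (measurableT_comp _ mf); apply: continuous_measurable_fun.
  exact: continuous_clip.
have ig : leb.-integrable `]0, 1[ (fun x => (f x ^+ 2 * w x)%:E).
  apply/integrableP; split; first exact: msq.
  move: foo; congr (_ < _)%E; apply: eq_integral => x _.
  by rewrite abse_EFin ger0_norm// mulr_ge0// sqr_ge0.
apply: ereal_cvg0_lt e0.
have := @dominated_convergence _ _ _ leb `]0, 1[ (measurable_itv _)
  (fun n x => ((f x - cutoff n x * clip n.+1%:R (f x)) ^+ 2 * w x)%:E)
  (cst 0%E) (fun x => (f x ^+ 2 * w x)%:E).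
case => //.
- by move=> n; exact: msq.
- apply: aeW => x /=; rewrite in_itv/= => /andP[x0 x1].
  apply: cvg_near_cst; near=> n.
  rewrite cutoff_eq1 ?clip_id ?mul1r ?subrr ?expr0n ?mul0r//.
    rewrite (@le_trans _ _ n%:R) ?ler_nat//.
    near: n; exact: nbhs_infty_ger.
  have xx : 0 < x * (1 - x) by rewrite mulr_gt0// subr_gt0.
  rewrite -ler_pdivrMr//; near: n; exact: nbhs_infty_ger.
- apply: aeW => x n _; rewrite abse_EFin lee_fin.
  rewrite ger0_norm; last by rewrite mulr_ge0// sqr_ge0.
  rewrite ler_wpM2r//.
  by apply: sqr_sub_clip; rewrite ?cutoff_itv.
by move=> _ _; rewrite integral0.
Unshelve. all: by end_near. Qed.

(* With [G = clip M (H / w)] and [H] an L1-approximation of [F w], the bound [M] on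
   [F] and [G] gives [(F - G)^2 w <= 2 M |F w - H|]. *)
Lemma wint_continuous_approx (F : R -> R) (M e : R) : measurable_fun D F ->
  0 < M -> (forall x, x \in `]0, 1[ -> `|F x| <= M) -> 0 < e ->
  exists G : R -> R, {in `]0, 1[, continuous G} /\
    (wint (F \- G)%R <= e%:E)%E.
Proof.
move=> mF M0 FM e0.
have iFw : leb.-integrable `]0, 1[ (EFin \o (fun x => F x * w x)).
  have iMw : leb.-integrable `]0, 1[ (fun x => M%:E * (w x)%:E)%E.
    exact: integrableZl.
  apply: le_integrable iMw => //.
    by apply/measurable_EFinP; exact: measurable_funM.
  move=> x x01; rewrite -EFinM !abse_EFin lee_fin !normrM.
  by rewrite ler_wpM2r// (ger0_norm (ltW M0)) FM.
have D1 : (leb D < +oo)%E by rewrite lebesgue_measure_itv/= lte_fin ltr01 -EFinB ltry.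
have [H [cH iH H0]] := approximation_continuous_integrable (measurable_itv _) D1 iFw.
have [n Hn] := ereal_cvg0_lt H0 (divr_gt0 e0 (mulr_gt0 (ltr0Sn R 1) M0)).
pose G x := clip M (H n x / w x).
have cG : {in `]0, 1[, continuous G}.
  move=> x x01; apply: (@continuous_comp _ _ _ (fun x => H n x / w x) (clip M)).
    apply: cvgM; first exact: cH.
    by apply: cvgV; [rewrite gt_eqF// w_gt0|exact: w_cont].
  exact: continuous_clip.
have mG : measurable_fun D G.
  apply: open_continuous_measurable_fun; first exact: interval_open.
  by move=> x; rewrite inE; exact: cG.
exists G; split=> //.
apply: (@le_trans _ _ ((2 * M)%:E * \int[leb]_(x in `]0%R, 1%R[) `|(F x * w x - H n x)%:E|)%E).
  rewrite -ge0_integralZl_EFin//; last 2 first.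
  - apply: measurableT_comp => //; apply/measurable_EFinP.
    apply: measurable_funB; first exact: measurable_funM.
    by apply: measurable_funTS; exact: continuous_measurable_fun.
  - by rewrite mulr_ge0// ltW.
  apply: ge0_le_integral => //.
  - by move=> x _; rewrite lee_fin mulr_ge0 ?sqr_ge0.
  - by apply: msq; exact: measurable_funB.
  - apply: measurable_funeM; apply: measurableT_comp => //; apply/measurable_EFinP.
    apply: measurable_funB; first exact: measurable_funM.
    by apply: measurable_funTS; exact: continuous_measurable_fun.
  move=> x x01; have wx := w_gt0 x01; rewrite abse_EFin -EFinM lee_fin /=.
  have FG : `|F x - G x| <= `|F x - H n x / w x|.
    by rewrite -{1}(clip_id (FM x x01)); apply: clip_lipschitz; exact: ltW.
  have FG2 : `|F x - G x| <= 2 * M.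
    rewrite (le_trans (ler_normB _ _))// mulr2n mulrDl mul1r lerD ?FM//.
    exact/clip_bound/ltW.
  have -> : F x * w x - H n x = (F x - H n x / w x) * w x.
    by rewrite mulrBl divfK// gt_eqF.
  rewrite normrM (gtr0_norm wx) mulrA ler_wpM2r// -real_normK ?num_real// expr2.
  by rewrite ler_pM.
rewrite -(@lee_pdivlMl _ (2 * M)) ?mulr_gt0//.
by rewrite -EFinM mulrC ltW.
Qed.

(** The cutoff vanishes near 0, so the quotient by x^m stays continuous on [0,1]. Approximate it by
    q; multiplying back by x^m <= 1 does not increase the error. *)
Lemma wint_cutoff_poly (G : R -> R) (d : R) (n m : nat) :
  {in `]0, 1[, continuous G} -> 0 < d ->
  exists q : {poly R}, forall x, x \in `]0, 1[ ->
    `|cutoff n x * G x - ('X^m * q).[x]| <= d.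
Proof.
move=> cG d0; pose h x := cutoff n x * G x / x ^+ m.
(* This covers both endpoints, where nothing is known about G: h is identically 0 nearby. *)
have ch0 (x : R) : n%:R * (x * (1 - x)) < 1 -> {for x, continuous h}.
  move=> nx.
  have pE (y : R) : (n%:R *: ('X * (1 - 'X))).[y] = n%:R * (y * (1 - y)).
    by rewrite !hornerE.
  have cp := @continuous_horner R (n%:R *: ('X * (1 - 'X))) x.
  have near0 : \forall y \near x, h y = 0.
    have : \forall y \near x, (n%:R *: ('X * (1 - 'X))).[y] < 1.
      by apply: (cvgr_lt _ cp); rewrite pE.
    apply: filterS => y; rewrite pE => ny.
    by rewrite /h cutoff_eq0 ?mul0r// ltW.
  rewrite /prop_for /continuous_at (nbhs_singleton near0).
  by apply: cvg_near_cst.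
have ch : {in `[0, 1], continuous h}.
  move=> x; rewrite in_itv/= => /andP[]; rewrite le_eqVlt => /predU1P[<- _|x0].
    by apply: ch0; rewrite mul0r mulr0.
  rewrite le_eqVlt => /predU1P[->|x1]; first by apply: ch0; rewrite subrr !mulr0.
  apply: cvgM.
    by apply: cvgM; [exact: continuous_cutoff|apply: cG; rewrite in_itv/= x0].
  by apply: cvgV; [rewrite expf_neq0// gt_eqF|exact: exprn_continuous].
have [q hq] := weierstrass d0 ch; exists q => x; rewrite in_itv/= => /andP[x0 x1].
have x01 : x \in `[0, 1] by rewrite in_itv/= !ltW.
have -> : cutoff n x * G x = x ^+ m * h x by rewrite /h [RHS]mulrC divfK// expf_neq0// gt_eqF.
rewrite hornerM hornerXn -mulrBr normrM -[leRHS]mul1r.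
by rewrite ler_pM ?hq// normrX exprn_ile1// ger0_norm// ltW.
Qed.

Lemma wint_dense (f : R -> R) (m : nat) (e : R) : measurable_fun D f ->
  (wint f < +oo)%E -> 0 < e ->
  exists q : {poly R}, (wint (f \- horner ('X^m * q))%R <= e%:E)%E.
Proof.
move=> mf foo e0.
(* Three errors of e / 16 are combined by two uses of [wint_add]: 2 e/16 + 2 (4 e/16) = 10 e/16 <=
   e. *)
have e16 : 0 < e / 16 by rewrite divr_gt0.
have [n fn] := wint_truncation mf foo e16.
pose F x := clip n.+1%:R (f x).
have mF : measurable_fun D F.
  apply: (measurableT_comp _ mf); apply: continuous_measurable_fun.
  exact: continuous_clip.
have FM x : x \in `]0, 1[ -> `|F x| <= n.+1%:R by move=> _; exact: clip_bound.
have [G [cG FG]] := wint_continuous_approx mF (ltr0Sn _ _) FM e16.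
have [W W0 Wsup] := wint_sup.
have [d [d0 d1 dW]] := small_factor W0 e16.
have [q Gq] := wint_cutoff_poly n m cG d0.
exists q.
have mc : measurable_fun D (cutoff n).
  by apply: measurable_funTS; apply: continuous_measurable_fun; exact: continuous_cutoff.
have mG : measurable_fun D G.
  apply: open_continuous_measurable_fun; first exact: interval_open.
  by move=> x; rewrite inE; exact: cG.
have mq : measurable_fun D (horner ('X^m * q)).
  by apply: measurable_funTS; apply: continuous_measurable_fun; exact: continuous_horner.
pose u1 x := f x - cutoff n x * F x; pose u2 x := cutoff n x * (F x - G x).
pose u3 x := cutoff n x * G x - ('X^m * q).[x].
have mu1 : measurable_fun D u1 by apply: measurable_funB => //; exact: measurable_funM.
have mu2 : measurable_fun D u2 by apply: measurable_funM => //; exact: measurable_funB.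
have mu3 : measurable_fun D u3 by apply: measurable_funB => //; exact: measurable_funM.
have -> : f \- horner ('X^m * q) = u1 \+ (u2 \+ u3).
  by apply/funext => x; rewrite /u1 /u2 /u3 /=; ring.
have h2 : (wint u2 <= (e / 16)%:E)%E.
  apply: le_trans FG; apply: ge0_le_integral => //.
  - by move=> x _; rewrite lee_fin mulr_ge0 ?sqr_ge0.
  - exact: msq.
  - by apply: msq; exact: measurable_funB.
  move=> x _; rewrite lee_fin ler_wpM2r// /u2 exprMn ler_piMl ?sqr_ge0//.
  by have /andP[c0 c1] := cutoff_itv n x; rewrite exprn_ile1.
have h3 : (wint u3 <= (e / 16)%:E)%E.
  apply: (le_trans (Wsup _ d mu3 Gq)); rewrite lee_fin (le_trans _ dW)// mulrC.
  by rewrite ler_wpM2l// expr2 ler_piMr// ltW.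
have h23 := wint_add mu2 mu3 h2 h3.
have := wint_add mu1 (measurable_funD mu2 mu3) (ltW fn) h23.
move/le_trans; apply; rewrite lee_fin; lra.
Qed.

End WeightedDensity.

(** * Convolution series *)

Section ConvolutionLinearity.
Variable R : realType.

Lemma convol_horner_linear (L : R -> R) (c x : R) (p q : {poly R}) : continuous L ->
  convol L (horner (c *: p + q)) x =
  c * convol L (horner p) x + convol L (horner q) x.
Proof.
move=> cL; rewrite /convol.
have i (r : {poly R}) : (@lebesgue_measure R).-integrable `[0, x]
    (EFin \o (fun t => L (x - t) * r.[t])).
  apply/continuous_integrable_itv/continuous_convol_integrand => //.
  exact: continuous_horner.
rewrite -RintegralZl// -RintegralD//.
  by apply: eq_Rintegral => t _; rewrite hornerD hornerZ; ring.
exact: (@integrableZl _ _ _ _ _ _ c _ (i p)).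
Qed.

Lemma convol_horner_sum (L : R -> R) (x : R) N (c : 'I_N -> R)
    (p : 'I_N -> {poly R}) : continuous L ->
  convol L (horner (\sum_(i < N) c i *: p i)) x =
  \sum_(i < N) c i * convol L (horner (p i)) x.
Proof.
move=> cL; have L0 : convol L (horner 0) x = 0.
  have := @convol_horner_linear L 1 x 0 0 cL.
  by rewrite scaler0 addr0; lra.
elim: N c p => [|N IH] c p; first by rewrite !big_ord0.
by rewrite !big_ord_recl convol_horner_linear// IH.
Qed.

End ConvolutionLinearity.

Theorem theorem3p1 (R : realType) (alpha beta : R)
    (halpha : -1 < alpha) (hbeta : -1 < beta)
    (m : nat) (hm : (1 <= m)%N)
    (kappa : R -> R) (hkappa : exists k : R -> R, left_sonine_pair m k kappa) :
  L2w_basis (jacobi_weight alpha beta)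
            (left_jacobi_convolution alpha beta kappa).
Proof.
have [k [Ck Ckappa sonine]] := hkappa.
have [K cK Kk] := Csigmam_continuous_extension hm Ck.
have [L cL Lkappa] := Csigmam_continuous_extension hm Ckappa.
pose w := jacobi_weight alpha beta; pose P n := shifted_jacobi alpha beta n.
have sizeP n : size (P n) = n.+1 by exact: size_shifted_jacobi.
have w0 := @jacobi_weight_ge0 R alpha beta.
have w1 := @jacobi_weight_gt0 R alpha beta.
have cw := @jacobi_weight_continuous R alpha beta.
have iw := integrable_jacobi_weight halpha hbeta.
have phiE n x : x \in `[0, 1] ->
    left_jacobi_convolution alpha beta kappa n x = convol L (horner (P n)) x.
  move=> x01; apply: eq_convol => // [|t t01].
    exact: continuous_horner.
  by rewrite Lkappa.
have KL x : x \in `]0, 1] -> convol K L x = (monomial_kernel R m.-1).[x].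
  move=> x01; rewrite -(@eq_convol _ k kappa) ?sonine//.
  - by rewrite /monomial_kernel hornerZ hornerXn mulrC.
  - by move=> t t01; rewrite Kk.
  - by move=> t t01; rewrite Lkappa.
  - by move: x01; rewrite !in_itv/= => /andP[/ltW ->].
have mconv p : measurable_fun (`[0%R, 1%R]%classic : set R) (convol L (horner p)).
  apply: subspace_continuous_measurable_fun => //.
  exact: continuous_convol_horner.
have mconvo p : measurable_fun (`]0%R, 1%R[%classic : set R) (convol L (horner p)).
  by apply: measurable_funS (mconv p) => //; exact: subset_itv_oo_cc.
have oo_cc (x : R) : x \in `]0, 1[ -> x \in `[0, 1] by exact: subset_itv_oo_cc.
have mw (u : R -> R) : measurable_fun (`]0%R, 1%R[%classic : set R) u ->
    measurable_fun (`]0%R, 1%R[%classic : set R) (fun x => (u x ^+ 2 * w x)%:E).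
  move=> mu; apply/measurable_EFinP; apply: measurable_funM.
    exact: measurable_funX.
  by case/integrableP : iw => /measurable_EFinP.
have wintE (u : R -> R) : measurable_fun (`]0%R, 1%R[%classic : set R) u ->
    (\int[lebesgue_measure]_(x in `[0%R, 1%R]) (u x ^+ 2 * w x)%:E)%E = wint w u.
  by move=> mu; rewrite integral_itv_bndoo//; exact: mw.
have eq_wint (u v : R -> R) : (forall x, x \in `]0, 1[ -> u x = v x) -> wint w u = wint w v.
  by move=> uv; apply: eq_integral => x; rewrite inE => x01; rewrite uv.
have mphio n : measurable_fun (`]0%R, 1%R[%classic : set R)
    (left_jacobi_convolution alpha beta kappa n).
  apply: eq_measurable_fun (mconvo (P n)) => x; rewrite inE => x01.
  by rewrite phiE// oo_cc.
have [W W0 Wsup] := wint_sup w0 iw.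
split.
(* Membership: the series members are continuous and bounded on [0,1], and w has finite mass. *)
- move=> n; split.
    apply: eq_measurable_fun (mconv (P n)) => x; rewrite inE => x01.
    by rewrite phiE.
  rewrite -/w wintE// (eq_wint _ (convol L (horner (P n)))); last first.
    by move=> x /oo_cc x01; rewrite phiE.
  have [NL NL0 LN] : exists2 M : R, 0 <= M &
      forall x, x \in `[0, 1] -> `|L x| <= M.
    by apply: bounded_on_unit_interval => x _; exact: cL.
  have [NP NP0 PN] := bounded_horner (P n).
  have oc_cc (x : R) : x \in `]0, 1] -> x \in `[0, 1].
    by rewrite !in_itv/= => /andP[/ltW ->].
  apply: le_lt_trans (Wsup _ (NL * NP) (mconvo (P n)) _) (ltry _) => x /oo_cc x01.
  apply: convol_bound => //; first exact: continuous_horner.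
    by move=> t /oc_cc; exact: LN.
  by move=> t /oc_cc; exact: PN.
- move=> N c cphi.
  apply: (size_basis_free sizeP).
  apply: (sonine_convol_ae_eq0 cK cL KL).
  apply: (@filterS _ _ (ae_filter_ringOfSetsType (@lebesgue_measure R))) cphi.
  move=> x + x01 => /(_ x01).
  rewrite convol_horner_sum// => s0; rewrite -[RHS]s0.
  by apply: eq_bigr => i _; rewrite phiE.
move=> f [mf foo] e e0.
have mfo : measurable_fun (`]0%R, 1%R[%classic : set R) f.
  by apply: measurable_funS mf => //; exact: subset_itv_oo_cc.
have wf : (wint w f < +oo)%E by rewrite -wintE.
(* Two errors of squared norm at most d0 add up to at most 4 d0 = e^2 / 2, strictly below e^2. *)
pose d0 : R := e ^+ 2 / 8; have d00 : 0 < d0 by rewrite divr_gt0 ?exprn_gt0.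
have [q fq] := wint_dense w0 w1 cw iw m mfo wf d00.
(* The kernel has exponent m - 1, so its range is the set of multiples of X^m, which contains the
   approximant X^m q. *)
have [r rE] := polyconvol_monomial_kernel_onto m.-1 q.
have [d [dpos d1 dW]] := small_factor W0 d00.
have [p pr] := sonine_convol_approx cK cL KL r dpos.
have [c pE] := size_basis_span sizeP (leqnn (size p)).
exists (size p), c.
set u := fun x => _; pose v (x : R) := ('X^m * q).[x] - convol L (horner p) x.
have mq : measurable_fun (`]0%R, 1%R[%classic : set R) (horner ('X^m * q)).
  apply: measurable_funTS; apply: continuous_measurable_fun.
  exact: continuous_horner.
have mv : measurable_fun (`]0%R, 1%R[%classic : set R) v by exact: measurable_funB.
have uv x : x \in `]0, 1[ -> u x = (f \- horner ('X^m * q)) x + v x.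
  move=> /oo_cc x01.
  have -> : v x = ('X^m * q).[x] - convol L (horner (\sum_(i < size p) c i *: P i)) x.
    by congr (_ - convol L (horner _) x).
  rewrite /u /= convol_horner_sum// addrA subrK.
  by congr (_ - _); apply: eq_bigr => i _; rewrite phiE.
have mu : measurable_fun (`]0%R, 1%R[%classic : set R) u.
  apply: measurable_funB => //; apply: measurable_sum => i.
  by apply: measurable_funM => //; exact: measurable_cst.
have hv : (wint w v <= d0%:E)%E.
  apply: (le_trans (Wsup v d mv _)) => [x /oo_cc x01|].
    by rewrite /v distrC -(prednK hm) -rE; exact: pr.
  rewrite lee_fin (le_trans _ dW)// mulrC ler_wpM2l// expr2 ler_piMr//.
  exact: ltW.
have hu : (wint w u <= (e ^+ 2 / 2)%:E)%E.
  rewrite (eq_wint _ _ uv).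
  have := wint_add w0 iw (measurable_funB mfo mq) mv fq hv.
  by move/le_trans; apply; rewrite lee_fin /d0; lra.
rewrite /L2w_norm /L2w_inner -[X in _ < X](ger0_norm (ltW e0)) -sqrtr_sqr.
rewrite ltr_sqrt ?exprn_gt0//.
have -> : \int[lebesgue_measure]_(x in `[0, 1]) (u x * u x * w x) = fine (wint w u).
  by rewrite -wintE.
have : (fine (wint w u) <= e ^+ 2 / 2).
  rewrite -lee_fin fineK// ge0_fin_numE ?(le_lt_trans hu) ?ltry//.
  by apply: integral_ge0 => x _; rewrite lee_fin mulr_ge0 ?sqr_ge0.
by have := exprn_gt0 2 e0; lra.
Qed.
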